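(* The following properties are equivalent. (1) Every $\aleph_0$-saturated pseudofinite group either contains a free nonabelian group or is amenable. (2) Every ultraproduct of finite groups either contains a free nonabelian group or is amenable. (3) Every finitely generated residually finite group satisfying a nontrivial identity is amenable. (4) Every finitely generated residually finite group satisfying a nontrivial identity is uniformly amenable.
   Context: A group $G$ is pseudofinite if it satisfies every first-order sentence (in the language of groups) true in all finite groups; finite groups are allowed. $\aleph_0$-saturated means: every type in finitely many variables over a finite set of parameters of $G$ is realized in $G$. A group satisfies a nontrivial identity if there is a nontrivial reduced word $w(x_1,\dots,x_k)$ in a free group with $w(g_1,\dots,g_k)=1$ for all $g_1,\dots,g_k$ in the group. A group $G$ is amenable if there is a finitely additive left-invariant measure $\mu:\mathcal{P}(G)\to[0,1]$ with $\mu(G)=1$. A group $G$ is uniformly amenable if there is a function $\alpha:(0,1]\times\mathbb{N}\to\mathbb{N}$ such that for every finite subset $A$ of $G$ and every $\epsilon\in(0,1]$ there is a finite subset $V$ of $G$ with $|V|\le\alpha(\epsilon,|A|)$ and $|AV|<(1+\epsilon)|V|$. *)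

(* Defs.v *)
From HB Require Import structures.
From mathcomp Require Import all_boot all_order all_algebra all_fingroup.
From mathcomp Require Import generic_quotient finmap.
From mathcomp Require Import all_classical reals.

Set Implicit Arguments.
Unset Strict Implicit.
Unset Printing Implicit Defensive.

Import Order.TTheory GRing.Theory Num.Theory.

Local Open Scope classical_set_scope.
Local Open Scope quotient_scope.
Local Open Scope group_scope.

(** * First-order logic in the language of groups

  [term C n] and [formula C n] are the terms and formulas with constants from
  [C] and free variables among ['I_n].  The quantifier [All] binds the variable
  [ord0] of its body and shifts the others by one.  Equality, falsity,
  implication and universal quantification form an adequate set for classical
  logic; the remaining connectives and the existential are abbreviations. *)

Inductive term (C : Type) (n : nat) : Type :=
  | Var of 'I_n
  | Cst of C
  | One
  | Mul of term C n & term C n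
  | Inv of term C n.

Inductive formula (C : Type) : nat -> Type :=
  | Eq n of term C n & term C n : formula C n
  | Bot n : formula C n
  | Imp n of formula C n & formula C n : formula C n
  | All n of formula C n.+1 : formula C n.

Definition env_cons (T : Type) n (x : T) (v : 'I_n -> T) (i : 'I_n.+1) : T :=
  if unlift ord0 i is Some j then v j else x.

Fixpoint eval (G : groupType) C (c : C -> G) n (v : 'I_n -> G)
    (t : term C n) : G :=
  match t with
  | Var i => v i
  | Cst a => c a
  | One => 1
  | Mul t1 t2 => eval c v t1 * eval c v t2
  | Inv t1 => (eval c v t1)^-1
  end.

Fixpoint holds (G : groupType) C (c : C -> G) n (phi : formula C n) :
    ('I_n -> G) -> Prop :=
  match phi in formula _ m return ('I_m -> G) -> Prop with
  | Eq _ t1 t2 => fun v => eval c v t1 = eval c v t2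
  | Bot _ => fun=> False
  | Imp _ phi1 phi2 => fun v => holds c phi1 v -> holds c phi2 v
  | All _ phi1 => fun v => forall x : G, holds c phi1 (env_cons x v)
  end.

Definition sentence := formula void 0.

(* A sentence has neither constants nor free variables, so the interpretation
   of constants and the valuation are irrelevant. *)
Definition satisfies (G : groupType) (phi : sentence) : Prop :=
  holds (of_void G) phi (fun=> 1).

Definition pseudofinite (G : groupType) : Prop :=
  forall phi : sentence,
    (forall F : finGroupType, satisfies F phi) -> satisfies G phi.

(* Formulas with parameters in [A : set G] are the formulas whose constants are
   taken in (the type coerced from) [A] and interpreted by themselves.  An
   [n]-type over [A] is a set of such formulas, not assumed to be complete,
   that is finitely satisfiable in [G]. *)
Definition is_type (G : groupType) (A : set G) n (p : set (formula A n)) :=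
  forall q : set (formula A n), finite_set q -> q `<=` p ->
    exists v : 'I_n -> G, forall phi, q phi -> holds val phi v.

Definition realizes (G : groupType) (A : set G) n (p : set (formula A n))
    (v : 'I_n -> G) : Prop :=
  forall phi, p phi -> holds val phi v.

Definition aleph0_saturated (G : groupType) : Prop :=
  forall (A : set G) n (p : set (formula A n)),
    finite_set A -> is_type p -> exists v, realizes p v.

(** * Free groups, as groups of reduced words

  The letter [(x, true)] stands for the generator [x] and [(x, false)] for its
  inverse. *)

Section FreeGroup.
Variable X : choiceType.
Implicit Types (a : X * bool) (u v w : seq (X * bool)).

Definition flip a : X * bool := (a.1, ~~ a.2).

Definition reduced w : bool := sorted (fun a b => b != flip a) w.

Definition cons_reduce a w :=
  if w is b :: w' then if b == flip a then w' else a :: w else [:: a].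

Definition word_mul u v := foldr cons_reduce v u.

Definition word_inv u := rev (map flip u).

Lemma flipK : involutive flip.
Proof. by case=> x b; rewrite /flip /= negbK. Qed.

Lemma reduced_cons_reduce a w : reduced w -> reduced (cons_reduce a w).
Proof.
case: w => [//|b w] /= rw; case: ifPn => [_|nb]; last by rewrite /= nb.
exact: path_sorted rw.
Qed.

Lemma cons_reduceK a w :
  reduced w -> cons_reduce a (cons_reduce (flip a) w) = w.
Proof.
case: w => [|b w] /=; first by rewrite eqxx.
rewrite flipK; case: (eqVneq b a) => [->|_] /=; last by rewrite eqxx.
by case: w => [//|c w] /= /andP[/negPf->].
Qed.

Lemma reduced_mul u v : reduced v -> reduced (word_mul u v).
Proof. by move=> rv; elim: u => //= a u; apply: reduced_cons_reduce. Qed.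

Lemma word_mulA u v w :
  reduced w -> word_mul u (word_mul v w) = word_mul (word_mul u v) w.
Proof.
move=> rw; elim: u => //= a u ->; move: (word_mul u v) => {u v}.
case=> [//|b v] /=; case: eqP => [->|//].
exact/cons_reduceK/reduced_mul.
Qed.

Lemma word_mulu0 u : reduced u -> word_mul u [::] = u.
Proof.
elim: u => //= a u IHu rau; have ru : reduced u := path_sorted rau.
rewrite IHu //.
by case: u rau {IHu ru} => [//|b u] /= /andP[/negPf->].
Qed.

Lemma word_invK : involutive word_inv.
Proof. by move=> u; rewrite /word_inv map_rev revK (mapK flipK). Qed.

Lemma reduced_inv u : reduced u -> reduced (word_inv u).
Proof.
rewrite /reduced rev_sorted sorted_map; apply: sub_sorted => a b /=.
by rewrite flipK eq_sym.
Qed.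

Lemma word_mulVu u : word_mul (word_inv u) u = [::].
Proof.
rewrite /word_mul /word_inv; elim: u => //= a u IHu.
by rewrite rev_cons foldr_rcons /= flipK eqxx.
Qed.

Definition free_group : Type := {w : seq (X * bool) | reduced w}.

HB.instance Definition _ := SubChoice.on free_group.

Definition free_one : free_group := exist _ [::] isT.
Definition free_mul (u v : free_group) : free_group :=
  exist _ (word_mul (val u) (val v)) (reduced_mul _ (valP v)).
Definition free_inv (u : free_group) : free_group :=
  exist _ (word_inv (val u)) (reduced_inv (valP u)).

Lemma free_mulA : associative free_mul.
Proof. by move=> u v w; apply/val_inj/word_mulA/valP. Qed.

Lemma free_mul1 : left_id free_one free_mul.
Proof. by move=> u; apply/val_inj. Qed.

Lemma free_mulr1 : right_id free_one free_mul.
Proof. by move=> u; apply/val_inj/word_mulu0/valP. Qed.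

Lemma free_mulV : left_inverse free_one free_inv free_mul.
Proof. by move=> u; apply/val_inj/word_mulVu. Qed.

Lemma free_mulrV : right_inverse free_one free_inv free_mul.
Proof.
move=> u; apply/val_inj.
by rewrite /= -{1}[val u]word_invK; apply: word_mulVu.
Qed.

HB.instance Definition _ :=
  isGroup.Build free_group free_mulA free_mul1 free_mulr1 free_mulV free_mulrV.

(* The value [w(g)] of the word [w] under the substitution [g]. *)
Definition word_value (G : groupType) (g : X -> G) (w : free_group) : G :=
  \prod_(a <- val w) (if a.2 then g a.1 else (g a.1)^-1).

End FreeGroup.

Definition satisfies_nontrivial_identity (G : groupType) : Prop :=
  exists k (w : free_group 'I_k),
    w <> 1 /\ forall g : 'I_k -> G, word_value g w = 1.

Definition contains_free_nonabelian (G : groupType) : Prop :=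
  exists (X : choiceType) (f : {multiplicative free_group X -> G}),
    injective f /\ ~ (forall u v : free_group X, commute u v).

(** * Ultraproducts *)

Section Ultraproduct.
Context (I : Type) (U : set_system I) {UU : UltraFilter U}.
Variable G : I -> groupType.

Definition ultra_eq (f g : forall i, G i) : bool :=
  `[< \forall i \near U, f i = g i >].

Lemma ultra_eq_refl : reflexive ultra_eq.
Proof. by move=> f; apply/asboolP; apply: nearW. Qed.

Lemma ultra_eq_sym : symmetric ultra_eq.
Proof. by move=> f g; apply/asboolP/asboolP; apply: filterS. Qed.

Lemma ultra_eq_trans : transitive ultra_eq.
Proof.
move=> g f h /asboolP fg /asboolP gh; apply/asboolP.
by apply: filterS2 fg gh => i -> ->.
Qed.

Canonical ultra_equiv :=
  EquivRel ultra_eq ultra_eq_refl ultra_eq_sym ultra_eq_trans.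

Definition ultraproduct : Type := {eq_quot ultra_equiv}.

HB.instance Definition _ := Choice.on ultraproduct.
HB.instance Definition _ := EqQuotient.on ultraproduct.

Definition ultra_class (f : forall i, G i) : ultraproduct :=
  \pi_({eq_quot ultra_equiv}) f.

Lemma ultra_classP f g :
  ultra_class f = ultra_class g <-> \forall i \near U, f i = g i.
Proof.
split=> [/eqP|fg]; first by rewrite eqmodE => /asboolP.
by apply/eqP; rewrite eqmodE; apply/asboolP.
Qed.

Definition ultra_one : ultraproduct := ultra_class (fun=> 1).
Definition ultra_mul (x y : ultraproduct) : ultraproduct :=
  ultra_class (fun i => repr x i * repr y i).
Definition ultra_inv (x : ultraproduct) : ultraproduct :=
  ultra_class (fun i => (repr x i)^-1).

Lemma ultra_repr f : \forall i \near U, repr (ultra_class f) i = f i.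
Proof. by apply/ultra_classP; rewrite /ultra_class reprK. Qed.

Lemma ultra_classK (x : ultraproduct) : ultra_class (repr x) = x.
Proof. exact: reprK. Qed.

Lemma ultra_mulE f g :
  ultra_mul (ultra_class f) (ultra_class g) = ultra_class (fun i => f i * g i).
Proof.
apply/ultra_classP.
by apply: filterS2 (ultra_repr f) (ultra_repr g) => i -> ->.
Qed.

Lemma ultra_invE f :
  ultra_inv (ultra_class f) = ultra_class (fun i => (f i)^-1).
Proof. by apply/ultra_classP; apply: filterS (ultra_repr f) => i ->. Qed.

Lemma ultra_mulA : associative ultra_mul.
Proof.
move=> x y z; rewrite -[x]ultra_classK -[y]ultra_classK -[z]ultra_classK.
by rewrite !ultra_mulE; apply/ultra_classP; apply: nearW => i; rewrite mulgA.
Qed.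

Lemma ultra_mul1 : left_id ultra_one ultra_mul.
Proof.
move=> x; rewrite -[x]ultra_classK ultra_mulE.
by apply/ultra_classP; apply: nearW => i; rewrite mul1g.
Qed.

Lemma ultra_mulr1 : right_id ultra_one ultra_mul.
Proof.
move=> x; rewrite -[x]ultra_classK ultra_mulE.
by apply/ultra_classP; apply: nearW => i; rewrite mulg1.
Qed.

Lemma ultra_mulV : left_inverse ultra_one ultra_inv ultra_mul.
Proof.
move=> x; rewrite -[x]ultra_classK ultra_invE ultra_mulE.
by apply/ultra_classP; apply: nearW => i; rewrite mulVg.
Qed.

Lemma ultra_mulrV : right_inverse ultra_one ultra_inv ultra_mul.
Proof.
move=> x; rewrite -[x]ultra_classK ultra_invE ultra_mulE.
by apply/ultra_classP; apply: nearW => i; rewrite mulgV.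
Qed.

HB.instance Definition _ :=
  isGroup.Build ultraproduct ultra_mulA ultra_mul1 ultra_mulr1
    ultra_mulV ultra_mulrV.

End Ultraproduct.

Arguments ultraproduct {I} U {UU} G.

(** * Group properties *)

Definition finitely_generated (G : groupType) : Prop :=
  exists S : seq G, forall H : {pred G},
    group_closed H -> {subset S <= H} -> forall x : G, x \in H.

Definition residually_finite (G : groupType) : Prop :=
  forall g : G, g <> 1 ->
    exists (F : finGroupType) (f : {multiplicative G -> F}), f g <> 1.

Definition amenable (R : realType) (G : groupType) : Prop :=
  exists mu : set G -> R,
    [/\ forall A, (0 <= mu A <= 1)%R,
        mu [set: G] = 1%R,
        forall A B, A `&` B = set0 -> mu (A `|` B) = (mu A + mu B)%R
      & forall (g : G) A, mu [set g * a | a in A] = mu A].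

(* The values of [alpha] outside of the half-open interval (0, 1] are
   irrelevant. *)
Definition uniformly_amenable (R : realType) (G : groupType) : Prop :=
  exists alpha : R -> nat -> nat,
    forall (A : {fset G}) (eps : R), (0 < eps <= 1)%R ->
      exists2 V : {fset G},
        (#|` V| <= alpha eps #|` A|)%N
      & (#|` [fset (a * v)%g | a in A, v in V]%fset|%:R
           < (1 + eps) * #|` V|%:R)%R.

(* Main.v *)
Require Import Defs.
From HB Require Import structures.
From mathcomp Require Import all_boot all_order all_algebra all_fingroup.
From mathcomp Require Import generic_quotient finmap.
From mathcomp Require Import all_classical reals.
From mathcomp Require Import lra.

(** All four properties say that finite groups satisfying a given identity
  have Folner sets of bounded size.

  Identities take the place of free subgroups.  A group with a nontrivial
  identity contains no free nonabelian group ([free_nonabelian_no_identity],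
  by ping-pong).  Conversely a saturated group without free nonabelian
  subgroup satisfies a nontrivial identity ([saturated_free_or_identity]): by
  saturation finitely many words cover all pairs of elements by their zero
  sets, and commutators combine finitely many words into one.  Ultraproducts
  of finite groups are among the saturated pseudofinite groups
  ([ultraproduct_saturated]).

  If every ultraproduct of finite groups satisfies the alternative, let [G] be
  residually finite with an identity.  It embeds into an ultraproduct of finite
  quotients of itself ([residually_finite_ultraproduct]); that ultraproduct
  satisfies the identity, so it is amenable, and amenability passes to [G].

  The heart is [uniform_folner]: if all finitely generated residually finite
  groups with an identity have Folner sets, then the size of these can be
  bounded in terms of the identity, the number of elements and [eps] only.
  Otherwise groups violating larger and larger bounds could be put together in
  one product, whose subgroup generated by the bad tuples is still finitely
  generated, residually finite and subject to the identity; a Folner set there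
  projects to a Folner set of the same size in each factor, up to passing to a
  level set of the multiplicity ([folner_image]).  Applied to copies of one
  group, this makes amenability uniform.  Applied to finite groups, it gives a
  bound that is a first-order sentence ([folner_sentence]), hence holds in
  every pseudofinite group with the identity.

  Amenability and the existence of Folner sets are exchanged by Folner's
  theorem.  A measure excludes doubling, because the marriage theorem would
  otherwise yield a paradoxical decomposition ([no_doubling]); conversely a
  measure is obtained as an ultralimit of densities in Folner sets
  ([folner_amenable]). *)

Set Implicit Arguments.
Unset Strict Implicit.
Unset Printing Implicit Defensive.

Import Order.TTheory GRing.Theory Num.Theory.

Local Open Scope classical_set_scope.
Local Open Scope group_scope.

(** * Words and their values *)

Section Morphisms.
Variables (G H : groupType) (f : G -> H).
Hypothesis fM : {morph f : x y / x * y}.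

Lemma morphism1 : f 1 = 1.
Proof. by apply: (mulgI (f 1)); rewrite -fM !mulg1. Qed.

Lemma morphismV : {morph f : x / x^-1}.
Proof. by move=> x; apply/esym/mulg1_eq; rewrite -fM mulgV morphism1. Qed.

Lemma morphism_inj : (forall x, f x = 1 -> x = 1) -> injective f.
Proof.
by move=> f1 x y xy; apply/divg1_eq/f1; rewrite fM morphismV xy mulgV.
Qed.

(** Homomorphisms are kept as plain functions with a morphism hypothesis, so
  that compositions and projections need no structure of their own; this
  produces the bundled form where a definition demands it. *)
Definition bundle_morphism : {multiplicative G -> H} :=
  HB.pack f (isMultiplicative.Build G H f fM).

End Morphisms.

Section WordValues.
Variable X : choiceType.

Definition letter_value (G : groupType) (g : X -> G) (a : X * bool) : G :=
  if a.2 then g a.1 else (g a.1)^-1.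

Lemma letter_value_flip (G : groupType) (g : X -> G) a :
  letter_value g (flip a) = (letter_value g a)^-1.
Proof. by case: a => x [] //=; rewrite /letter_value /= invgK. Qed.

Definition seq_value (G : groupType) (g : X -> G) (s : seq (X * bool)) : G :=
  \prod_(a <- s) letter_value g a.

Lemma word_valueE (G : groupType) (g : X -> G) (w : free_group X) :
  word_value g w = seq_value g (val w).
Proof. by []. Qed.

Lemma seq_value_cons (G : groupType) (g : X -> G) a s :
  seq_value g (a :: s) = letter_value g a * seq_value g s.
Proof. by rewrite /seq_value big_cons. Qed.

Lemma seq_value_cat (G : groupType) (g : X -> G) s t :
  seq_value g (s ++ t) = seq_value g s * seq_value g t.
Proof. by rewrite /seq_value big_cat. Qed.

Lemma seq_value_inv (G : groupType) (g : X -> G) s :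
  seq_value g (word_inv s) = (seq_value g s)^-1.
Proof.
elim: s => [|a s IHs]; first by rewrite /seq_value !big_nil invg1.
rewrite /word_inv /= rev_cons -cats1 seq_value_cat IHs !seq_value_cons.
by rewrite letter_value_flip /seq_value big_nil mulg1 invgM.
Qed.

Lemma word_valueM (G : groupType) (g : X -> G) :
  {morph word_value g : u v / u * v}.
Proof.
move=> u v; rewrite !word_valueE /= /word_mul.
elim: (val u) => [|a s IHs] /=; first by rewrite /seq_value big_nil mul1g.
rewrite seq_value_cons -mulgA -IHs; case: (foldr _ _ _) => [|b t] /=.
  by rewrite seq_value_cons.
case: eqP => [->|_]; rewrite ?seq_value_cons //.
by rewrite letter_value_flip mulVKg.
Qed.

Lemma morph_word_value (G H : groupType) (f : G -> H)
    (fM : {morph f : x y / x * y}) (g : X -> G) w :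
  f (word_value g w) = word_value (f \o g) w.
Proof.
rewrite /word_value (big_morph f fM (morphism1 fM)); apply: eq_bigr => a _ /=.
by case: a.2 => //; rewrite morphismV.
Qed.

End WordValues.

Lemma word_neq1P (X : choiceType) (w : free_group X) : w <> 1 -> val w != [::].
Proof. by move=> w1; apply/eqP => w0; apply/w1/val_inj. Qed.

Section MapWords.
Variables (X Y : choiceType) (h : X -> Y).
Hypothesis h_inj : injective h.

Lemma reduced_map s :
  reduced s -> reduced [seq (h a.1, a.2) | a <- s].
Proof.
rewrite /reduced sorted_map; apply: sub_sorted => -[x b] [y c] /=.
apply: contra => /eqP[/h_inj -> ->]; exact: eqxx.
Qed.

Lemma seq_value_map (G : groupType) (g : Y -> G) s :
  seq_value g [seq (h a.1, a.2) | a <- s] = seq_value (g \o h) s.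
Proof. by rewrite /seq_value big_map. Qed.

Definition map_word (w : free_group X) : free_group Y :=
  exist (fun s => is_true (reduced s)) _ (reduced_map (valP w)).

End MapWords.

Definition letter_word (X : choiceType) (x : X) : free_group X :=
  exist _ [:: (x, true)] isT.

(** A letter that does not occur in a reduced word cannot cancel against it,
  so such letters may be interleaved freely with nonempty reduced words. *)
Lemma path_fresh (X : choiceType) (z : X) b b' (s t : seq (X * bool)) :
    all (fun a => a.1 != z) s -> s != [::] -> reduced s ->
    path (fun a b => b != flip a) (z, b') t ->
  path (fun a b => b != flip a) (z, b) (s ++ (z, b') :: t).
Proof.
case: s => [//|a s] /= /andP[az sz] _ rs zt; rewrite cat_path rs /= zt andbT.
apply/andP; split; first by apply: contraNneq az => ->.
have: (last a s).1 != z.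
  by have /allP/(_ _ (mem_last a s)) : all (fun a => a.1 != z) (a :: s);
    rewrite //= az.
by apply: contraNneq; case: (last a s) => x c [->].
Qed.

(** Commutators turn a disjunction of equations into one equation: with a
  fresh letter [z], the commutator of [z u z^-1] and [v] dies as soon as [u]
  or [v] does, and it is nontrivial because nothing cancels in it.  A fresh
  letter is the cheap way to ensure this: within a fixed alphabet, [u] and
  [v] could commute. *)
Lemma combine_words k (u v : free_group 'I_k) : u <> 1 -> v <> 1 ->
  exists2 w : free_group 'I_k.+1, w <> 1 &
    forall (G : groupType) (g : 'I_k.+1 -> G),
      word_value (g \o lift ord0) u = 1 \/ word_value (g \o lift ord0) v = 1 ->
      word_value g w = 1.
Proof.
move=> /word_neq1P u0 /word_neq1P v0.
pose m (s : seq ('I_k * bool)) := [seq (lift ord0 a.1, a.2) | a <- s].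
have mfresh s : all (fun a => a.1 != ord0) (m s).
  by rewrite all_map; apply/allP => a _.
have m0 s : s != [::] -> m s != [::] by case: s.
have mr s : reduced s -> reduced (m s) by apply/reduced_map/lift_inj.
have i0 (s : seq ('I_k * bool)) : s != [::] -> word_inv s != [::].
  by rewrite -!size_eq0 /word_inv size_rev size_map.
pose z b : 'I_k.+1 * bool := (ord0, b).
(* This is the word z u z^-1 v z u^-1 z^-1 v^-1. *)
pose s := z true :: m (val u) ++ z false :: m (val v) ++ z true ::
          m (word_inv (val u)) ++ z false :: m (word_inv (val v)).
have rs : reduced s.
  rewrite /s /=; do 3?[apply: path_fresh;
    rewrite ?m0 ?i0 ?mr ?reduced_inv ?(valP u) ?(valP v) //].
  have : path (fun a b => b != flip a) (z false)
      (m (word_inv (val v)) ++ [:: z true]).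
    by apply: path_fresh; rewrite ?m0 ?i0 ?mr ?reduced_inv ?(valP v).
  by rewrite cat_path => /andP[].
exists (exist _ s rs); first by move=> /(congr1 val).
move=> G g; rewrite !word_valueE [val (exist _ _ _)]/= /s.
rewrite !(seq_value_cons, seq_value_cat, seq_value_map) !seq_value_inv /=.
rewrite [letter_value g (z false)](letter_value_flip _ (z true)).
by case=> ->; rewrite !gnorm ?mulgK ?mulgV.
Qed.

(** Each application of [combine_words] adds a letter, so the original words
  survive only up to an injection [h] of alphabets. *)
Lemma combine_word_list k (ws : seq (free_group 'I_k)) :
    (forall w, w \in ws -> w <> 1) -> ws != [::] ->
  exists n (h : 'I_k -> 'I_n) (w : free_group 'I_n), w <> 1 /\
    forall (G : groupType) (g : 'I_n -> G),
      (exists2 u, u \in ws & word_value (g \o h) u = 1) -> word_value g w = 1.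
Proof.
(* Splitting off one word makes the induction start from a nonempty list. *)
suff main w0 : w0 <> 1 -> (forall w, w \in ws -> w <> 1) ->
  exists n (h : 'I_k -> 'I_n) (w : free_group 'I_n), w <> 1 /\ injective h /\
    forall (G : groupType) (g : 'I_n -> G),
      (exists2 u, u \in w0 :: ws & word_value (g \o h) u = 1) ->
      word_value g w = 1.
  case: ws main => [//|w0 ws] main ws1 _.
  have [|w wws|n [h [w [w1 [_ ww]]]]] := main w0.
  - by apply: ws1; rewrite mem_head.
  - exact: ws1.
  exists n, h, w; split=> // G g [u uws ug]; apply: ww; exists u => //.
  by rewrite inE uws orbT.
move=> w01; elim: ws => [_|v ws IHws ws1].
  by exists k, id, w0; do 2!split=> //; move=> G g [u]; rewrite inE => /eqP->.
have [w wws|n [h [w [w1 [h_inj ww]]]]] := IHws.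
  by apply: ws1; rewrite inE wws orbT.
have v1 : v <> 1 by apply: ws1; rewrite mem_head.
pose hv := map_word h_inj v.
have hv1 : hv <> 1.
  move=> /(congr1 (fun w : free_group _ => size (val w))) /eqP.
  by rewrite size_map size_eq0 (negPf (word_neq1P v1)).
have [w' w'1 w'P] := combine_words w1 hv1.
exists n.+1, (lift ord0 \o h), w'; split=> //; split.
  exact: (inj_comp (@lift_inj _ ord0) h_inj).
move=> G g [u]; rewrite !inE => uin ug; apply: w'P.
have [uv|uv] := eqVneq u v; [right|left].
  by rewrite word_valueE seq_value_map -word_valueE -uv.
by apply: ww; exists u; rewrite // inE; move: uin; rewrite (negPf uv).
Qed.

(** * Nonabelian free groups satisfy no identity *)

Lemma free_cons_reduceE (X : choiceType) (x : X) b (u : free_group X) :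
  val ((if b then letter_word x else (letter_word x)^-1) * u) =
  cons_reduce (x, b) (val u).
Proof. by case: b. Qed.

Section PingPong.
Variables (X : choiceType) (x y : X).
Hypothesis xy : x != y.
Local Notation F := (free_group X).

(** The conjugates [x^i y x^-i] freely generate a subgroup, which gives free
  subgroups of every finite rank inside the free group on [x] and [y]. *)
Definition conjugate_letter (i : nat) : F :=
  letter_word x ^+ i * letter_word y * letter_word x ^- i.

(** The words which, once translated by [x^-i], start with the letter
  [y^b] (the boolean [b] is the sign of the exponent). *)
Definition ping_set (i : nat) (b : bool) (v : F) : bool :=
  if val (letter_word x ^- i * v) is a :: _ then a == (y, b) else false.

Lemma val_letterX i : val (letter_word x ^+ i) = nseq i (x, true).
Proof.
elim: i => // i IHi; rewrite expgS (free_cons_reduceE x true) IHi.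
by case: i {IHi} => //= i; rewrite /flip /= xpair_eqE eqxx.
Qed.

Lemma val_letterVX i : val (letter_word x ^- i) = nseq i (x, false).
Proof.
by rewrite /= val_letterX /word_inv map_nseq rev_nseq.
Qed.

Lemma letterVX_mul d (v : F) b s : val v = (y, b) :: s ->
  val (letter_word x ^- d * v) = nseq d (x, false) ++ val v.
Proof.
move=> vE; rewrite [LHS]/= -[word_inv _]/(val (letter_word x ^- d)).
rewrite val_letterVX /word_mul; elim: d => //= d ->.
case: d => [|d]; first by rewrite vE /= xpair_eqE /= eq_sym (negPf xy).
by rewrite /= /flip /= xpair_eqE andbF.
Qed.

Lemma ping_set1 i b : ping_set i b 1 = false.
Proof.
rewrite /ping_set mulg1 val_letterVX; case: i => //= i.
by rewrite xpair_eqE (negPf xy).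
Qed.

(** If [x^-i v] starts with [y^b], then for [j] larger than [i] the word
  [x^-j v] is obtained by prepending letters [x^-1] without cancellation, so
  it does not start with a power of [y]. *)
Lemma ping_set_disjoint i b j c v :
  ping_set i b v -> ping_set j c v -> (i, b) = (j, c).
Proof.
wlog ij : i b j c / (i <= j)%N => [th|].
  by case/orP: (leq_total i j) => ij ? ?; [|symmetry]; apply: th.
rewrite /ping_set; case vE: (val (_ * v)) => [//|a s] /eqP aE.
rewrite -(subnKC ij) expgnDr invgM -mulgA.
rewrite (letterVX_mul (j - i) (b := b) (s := s)); last by rewrite vE aE.
rewrite vE; case: (j - i)%N (subnKC ij) => [|d _] /=; last first.
  by rewrite xpair_eqE (negPf xy).
by rewrite addn0 aE => -> /eqP[->].
Qed.

(** The ping-pong step: translating by [x^-i] turns the action of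
  [x^i y^b x^-i] into left multiplication by [y^b], which is visible in the
  first letter unless that letter cancels. *)
Lemma ping_set_move i b v : ~~ ping_set i (~~ b) v ->
  ping_set i b
    ((if b then conjugate_letter i else (conjugate_letter i)^-1) * v).
Proof.
rewrite /ping_set; set u := letter_word x ^- i * v.
have -> : letter_word x ^- i *
    ((if b then conjugate_letter i else (conjugate_letter i)^-1) * v) =
    (if b then letter_word y else (letter_word y)^-1) * u.
  by rewrite /conjugate_letter /u; case: b;
    rewrite ?invgM ?invgK !mulgA mulVg mul1g.
rewrite free_cons_reduceE; case: (val u) => [|a s] /=; first by rewrite eqxx.
by rewrite {1}/flip /= => /negPf->; rewrite eqxx.
Qed.

(** Letting the letters of [w] act on the empty word, from the last one to
  the first, the image stays in the ping-pong set of the letter applied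
  last; the empty word lies in none of these sets. *)
Lemma conjugate_letters_free k (w : free_group 'I_k) : w <> 1 ->
  word_value (fun i : 'I_k => conjugate_letter i) w <> 1.
Proof.
move=> /word_neq1P w0; rewrite word_valueE.
suff {w w0} main (s : seq ('I_k * bool)) : reduced s ->
    if s is a :: _ then
      ping_set a.1 a.2 (seq_value (fun i : 'I_k => conjugate_letter i) s)
    else true.
  by have := main _ (valP w); case: (val w) w0 => [//|a s] _ + E;
    rewrite E ping_set1.
elim: s => [//|[i b] s IHs] rs; rewrite seq_value_cons.
apply: ping_set_move; have {IHs} := IHs (path_sorted rs).
case: s rs => [|[j c] s] /=; first by rewrite /seq_value big_nil ping_set1.
case/andP=> + _ pj; apply: contra => pi.
have [ji ->] := ping_set_disjoint pj pi.
by rewrite /flip /= xpair_eqE eqxx -val_eqE /= ji eqxx.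
Qed.

End PingPong.

(** With at most one letter, every word is a power of that letter. *)
Lemma free_nonabelian_letters (X : choiceType) :
  ~ (forall u v : free_group X, commute u v) -> exists x y : X, x != y.
Proof.
move=> ab; apply: contrapT => noxy; apply: ab.
have xE (x y : X) : x = y.
  by apply: contrapT => /eqP xy; apply: noxy; exists x, y.
have vE (u : free_group X) : u = word_value (@letter_word X) u.
  apply: val_inj; rewrite word_valueE;
    elim: (val u) (valP u) => [|[x b] s IHs] rs.
    by rewrite /seq_value big_nil.
  rewrite seq_value_cons free_cons_reduceE -(IHs (path_sorted rs)).
  by case: s rs {IHs} => //= c s /andP[/negPf->].
have letterC (b c : X * bool) :
    commute (letter_value (@letter_word X) b)
            (letter_value (@letter_word X) c).
  rewrite /letter_value (xE b.1 c.1).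
  by case: b.2 c.2 => -[]; do ?[exact: commute_refl]; [|apply/commute_sym];
    apply: commuteV; exact: commute_refl.
move=> u v; rewrite (vE u) (vE v) !word_valueE.
apply: commute_prod => b _; apply/commute_sym; apply: commute_prod => c _.
exact: letterC.
Qed.

Lemma free_nonabelian_no_identity (G : groupType) :
  contains_free_nonabelian G -> ~ satisfies_nontrivial_identity G.
Proof.
move=> [X [f [f_inj /free_nonabelian_letters[x [y xy]]]]] [k [w [w1 wG]]].
apply: (conjugate_letters_free xy w1); apply: f_inj.
have fM : {morph f : u v / u * v} := @gmulfM _ _ f.
by rewrite (morphism1 fM) (morph_word_value fM) wG.
Qed.

(** * The marriage theorem for infinite graphs with finite degrees *)

Section Rado.
Variables (V Y : choiceType) (N : V -> {fset Y}).

(** The graph is given by the neighbourhoods [N]; [X] is a set of deleted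
  edges.  Rado's proof deletes as many edges as the marriage condition
  tolerates and finds that what remains is a matching. *)
Definition edges_left (X : set (V * Y)) (x : V) : {fset Y} :=
  [fset y in N x | ~~ `[< X (x, y) >]]%fset.

Definition neighbours (X : set (V * Y)) (S : {fset V}) : {fset Y} :=
  (\bigcup_(x <- S) edges_left X x)%fset.

Definition hall_condition (X : set (V * Y)) : Prop :=
  forall S : {fset V}, (#|` S| <= #|` neighbours X S|)%N.

Lemma mem_edges_left X x y :
  (y \in edges_left X x) = (y \in N x) && ~~ `[< X (x, y) >].
Proof. by rewrite !inE. Qed.

Lemma neighboursP X S y :
  reflect (exists2 x, x \in S & y \in edges_left X x) (y \in neighbours X S).
Proof.
apply: (iffP (bigfcupP _ _ _ _)) => [[x /andP[xS _] yx]|[x xS yx]];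
  by exists x => //; rewrite xS.
Qed.

(** The marriage condition speaks of finitely many edges at a time, as the
  degrees are finite; the deleted ones among them are already all deleted at
  one stage of the chain. *)
Lemma hall_condition_chain (F : set (set (V * Y))) :
  hall_condition set0 -> F `<=` hall_condition -> total_on F subset ->
  hall_condition (\bigcup_(X in F) X).
Proof.
move=> H0 FH Ftot S.
have fin (L : seq (V * Y)) : (forall p, p \in L -> (\bigcup_(X in F) X) p) ->
    exists X, [/\ F X \/ X = set0, X `<=` \bigcup_(X in F) X
                & forall p, p \in L -> X p].
  elim: L => [_|p L IHL LF].
    by exists set0; split; [right|exact: sub0set|].
  have [q qL|X [FX XF LX]] := IHL; first by apply: LF; rewrite inE qL orbT.
  have [X' FX' X'p] := LF p (mem_head _ _).
  have [XX'|X'X] : X `<=` X' \/ X' `<=` X.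
    by case: FX => [FX|->]; [exact: Ftot|left; exact: sub0set].
  - exists X'; split; [by left|by move=> q X'q; exists X'|].
    by move=> q; rewrite inE => /predU1P[->//|/LX/XX'].
  - by exists X; split=> // q; rewrite inE => /predU1P[->|/LX//]; exact: X'X.
set Z := \bigcup_(X in F) X in fin *.
pose L := [seq p <- [seq (x, y) | x <- S, y <- N x] | `[< Z p >]].
have [p|X [FX XZ LX]] := fin L; first by rewrite mem_filter => /andP[/asboolP].
have -> : neighbours Z S = neighbours X S.
  apply/fsetP => y; apply/neighboursP/neighboursP => -[x xS];
    rewrite mem_edges_left => /andP[yx nZ]; exists x => //;
    rewrite mem_edges_left yx /=; apply: contra nZ => /asboolP h;
      apply/asboolP.
    exact: XZ.
  apply: LX; rewrite mem_filter; apply/andP; split; first exact/asboolP.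
  by apply/allpairsPdep; exists x, y.
by case: FX => [/FH|->]; exact.
Qed.

Lemma neighboursU X S T :
  neighbours X (S `|` T)%fset = (neighbours X S `|` neighbours X T)%fset.
Proof.
apply/fsetP => y; rewrite in_fsetU; apply/neighboursP/orP.
  by case=> x; rewrite in_fsetU => /orP[] xS yx; [left|right];
    apply/neighboursP; exists x.
by case=> /neighboursP[x xS yx]; exists x => //; rewrite in_fsetU xS ?orbT.
Qed.

Lemma neighbours1 X x : neighbours X [fset x]%fset = edges_left X x.
Proof.
apply/fsetP => y; apply/neighboursP/idP => [[z]|yx].
  by rewrite in_fset1 => /eqP->.
by exists x; rewrite ?in_fset1.
Qed.

Lemma neighbours_setU1 X x a S :
  x \notin S -> neighbours (X `|` [set (x, a)]) S = neighbours X S.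
Proof.
move=> xS; apply/fsetP => y; apply/neighboursP/neighboursP => -[z zS];
  rewrite mem_edges_left => /andP[yz nX]; exists z => //;
  rewrite mem_edges_left yz; apply: contra nX => /asboolP h; apply/asboolP.
  by left.
by case: h => //= -[zx _]; rewrite -zx zS in xS.
Qed.

Lemma edges_left_setU1 X x a :
  edges_left (X `|` [set (x, a)]) x = (edges_left X x `\ a)%fset.
Proof.
apply/fsetP => y; rewrite in_fsetD1 !mem_edges_left andbCA; congr (_ && _).
apply/idP/andP => [nX|[ya nX]].
  split; first by apply: contra nX => /eqP->; apply/asboolP; right.
  by apply: contra nX => /asboolP h; apply/asboolP; left.
by apply: contra nX => /asboolP[h|[/eqP]]; [exact/asboolP|rewrite (negPf ya)].
Qed.

(** Rado's lemma.  If neither deletion were possible, there would be finite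
  sets [S] and [T] of vertices other than [x] witnessing this.  Their
  neighbourhoods, each enlarged by the rest of that of [x], have a union and
  an intersection that contain the neighbourhoods of [S], [T] and [x]
  together, and of the vertices common to [S] and [T]; by modularity of
  cardinality, the marriage condition for these would then demand one
  neighbour more than the sizes of [S] and [T] allow. *)
Lemma hall_condition_remove X x a b : hall_condition X ->
    a \in edges_left X x -> b \in edges_left X x -> a != b ->
  hall_condition (X `|` [set (x, a)]) \/
  hall_condition (X `|` [set (x, b)]).
Proof.
move=> HX aX bX ab; apply: contrapT => /not_orP[].
have fail c : c \in edges_left X x ->
    ~ hall_condition (X `|` [set (x, c)]) ->
    exists2 S, x \notin S &
      (#|` (neighbours X S `|` (edges_left X x `\ c))%fset| <= #|` S|)%N.
  move=> cX /existsNP[S /negP]; rewrite -ltnNge => lS.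
  have xS : x \in S.
    by apply: contraLR lS => xS; rewrite neighbours_setU1 // -leqNgt;
      exact: HX.
  exists (S `\ x)%fset; first by rewrite fsetD11.
  have SE : S = ((S `\ x) `|` [fset x])%fset by rewrite fsetUC fsetD1K.
  move: lS; rewrite {1}SE neighboursU neighbours1 neighbours_setU1 ?fsetD11 //.
  by rewrite edges_left_setU1 (cardfsD1 x S) xS add1n ltnS.
move=> /(fail _ aX)[S xS lS] /(fail _ bX)[T xT lT].
set P := (_ `|` _)%fset in lS; set Q := (_ `|` _)%fset in lT.
have PQU : (#|` (S `|` T)%fset|.+1 <= #|` (P `|` Q)%fset|)%N.
  have := HX ((S `|` T) `|` [fset x])%fset.
  rewrite fsetUC cardfsU1 in_fsetU (negPf xS) (negPf xT) /= => h.
  apply: leq_trans h (fsubset_leq_card _).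
  rewrite !neighboursU neighbours1; apply/fsubsetP => y;
    rewrite !in_fsetU !in_fsetD1.
  have [->|ya] := eqVneq y a; first by rewrite ab aX !orbT.
  by case: (y \in edges_left X x); rewrite ?orbF ?andbF ?orbT //=
    => /orP[->|->]; rewrite ?orbT.
have PQI : (#|` (S `&` T)%fset| <= #|` (P `&` Q)%fset|)%N.
  apply: leq_trans (HX _) (fsubset_leq_card _); apply/fsubsetP => y.
  case/neighboursP => z; rewrite in_fsetI => /andP[zS zT] yz.
  rewrite in_fsetI !in_fsetU; apply/andP; split; apply/orP; left;
    by apply/neighboursP; exists z.
have := leq_add PQU PQI; rewrite addSn !cardfsUI ltnNge => /negP; apply.
exact: leq_add.
Qed.

(** A maximal set of deletions exists by Zorn's lemma, and by Rado's lemma it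
  leaves one edge at each vertex.  Two vertices cannot share their edge's
  end, since the marriage condition holds for pairs. *)
Theorem hall_marriage : hall_condition set0 ->
  exists phi : V -> Y, injective phi /\ forall x, phi x \in N x.
Proof.
move=> H0.
have [X [HX Xmax]] := Zorn_bigcup
  (fun F FH Ftot => hall_condition_chain H0 FH Ftot).
have X1 x : exists y, edges_left X x = [fset y]%fset.
  have /fset0Pn[y yx] : edges_left X x != fset0.
    by rewrite -cardfs_gt0 -neighbours1; apply: leq_trans (HX _);
      rewrite cardfs1.
  exists y; apply/fsetP => z; rewrite in_fset1; apply/idP/eqP => [zx|->//].
  apply/eqP; apply: contrapT => /negP zy.
  have nX c : c \in edges_left X x ->
    hall_condition (X `|` [set (x, c)]) -> False.
    rewrite mem_edges_left => /andP[_ /asboolPn nXc] Hc; apply: Xmax Hc.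
    split; first exact: subsetUl.
    by move=> sub; apply: nXc; apply: sub; right.
  by case: (hall_condition_remove HX zx yx zy); exact: nX.
have [phi phiE] := choice X1; exists phi; split=> [x x' xx'|x].
  apply/eqP; apply: contrapT => /negP nxx'.
  have := HX [fset x; x']%fset; rewrite neighboursU !neighbours1 !phiE xx'.
  by rewrite fsetUid cardfs2 cardfs1 nxx'.
by have := fset11 (phi x); rewrite -phiE mem_edges_left => /andP[].
Qed.
End Rado.

(** * Amenable groups have Folner sets *)

Section SetProducts.
Variable G : groupType.
Implicit Types A B V : {fset G}.

Definition left_mul A V : {fset G} := [fset (a * v)%g | a in A, v in V]%fset.

Lemma left_mulP A V x :
  reflect (exists a v, [/\ a \in A, v \in V & x = a * v]) (x \in left_mul A V).
Proof.
apply: (iffP (imfset2P _ _ _ _ _)) => [[a aA [v vV ->]]|[a [v [aA vV ->]]]].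
  by exists a, v.
by exists a; last exists v.
Qed.

Lemma left_mulA A B V : left_mul A (left_mul B V) = left_mul (left_mul A B) V.
Proof.
apply/fsetP => x; apply/left_mulP/left_mulP.
  case=> a [_ [aA /left_mulP[b [v [bB vV ->]]] ->]].
  by exists (a * b), v; rewrite mulgA; split=> //; apply/left_mulP;
    exists a, b.
case=> _ [v [/left_mulP[a [b [aA bB ->]]] vV ->]].
by exists a, (b * v); rewrite mulgA; split=> //; apply/left_mulP; exists b, v.
Qed.

Lemma left_mul1 V : left_mul [fset 1]%fset V = V.
Proof.
apply/fsetP => x; apply/left_mulP/idP.
  by case=> a [v [/fset1P-> vV ->]]; rewrite mul1g.
by exists 1, x; rewrite fset11 mul1g.
Qed.

Lemma left_mulS A B V : {subset A <= B} ->
  {subset left_mul A V <= left_mul B V}.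
Proof.
move=> AB x /left_mulP[a [v [aA vV ->]]]; apply/left_mulP.
by exists a, v; rewrite AB.
Qed.

Lemma iter_left_mul A V n :
  iter n (left_mul A) V = left_mul (iter n (left_mul A) [fset 1]%fset) V.
Proof. by elim: n => [|n IHn] /=; rewrite ?left_mul1 // IHn left_mulA. Qed.

Definition folner (R : realType) (eps : R) A V : Prop :=
  (#|` left_mul A V|%:R < (1 + eps) * #|` V|%:R)%R.

End SetProducts.

Definition has_folner_sets (R : realType) (G : groupType) : Prop :=
  forall (A : {fset G}) (eps : R), (0 < eps <= 1)%R ->
    exists V, folner eps A V.

Section AmenableFolner.
Variables (R : realType) (G : groupType) (mu : set G -> R).
Hypothesis mu01 : forall A, (0 <= mu A <= 1)%R.
Hypothesis muT : mu setT = 1%R.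
Hypothesis muU : forall A B, A `&` B = set0 -> mu (A `|` B) = (mu A + mu B)%R.
Hypothesis muM : forall (g : G) A, mu [set g * a | a in A] = mu A.

(** An injection that displaces points by finitely many group elements only
  is a translation on each of finitely many pieces. *)
Lemma measure_bounded_displacement (psi : G -> G) (s : seq G) (C : set G) :
    injective psi -> (forall g, C g -> psi g * g^-1 \in s) ->
  mu [set psi g | g in C] = mu C.
Proof.
move=> psi_inj; elim: s C => [|h s IHs] C Cs.
  suff -> : C = set0 by rewrite image_set0.
  by apply/seteqP; split=> // g /Cs.
pose D := [set g | psi g * g^-1 = h].
have dis A B : A `&` B = set0 -> psi @` A `&` psi @` B = set0.
  move=> AB0; apply/seteqP; split=> // _ [[a Aa <-] [b Bb /psi_inj ba]].
  by have : (A `&` B) a by [split; rewrite // -ba]; rewrite AB0.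
have CD0 : (C `&` D) `&` (C `\` D) = set0.
  by apply/seteqP; split=> // g [[_ ?] []].
rewrite -(setUIDK C D) image_setU !muU //; last exact: dis.
congr (_ + _)%R.
  rewrite -(muM h (C `&` D)); congr mu; apply/seteqP; split=> _ [g [Cg Dg] <-];
    by exists g; rewrite // -Dg mulgVK.
apply: IHs => g [Cg nDg]; have := Cs _ Cg.
by rewrite inE => /predU1P[].
Qed.

(** If left multiplication by [B] doubled every finite set, the marriage
  theorem, applied to two copies of the group, would give two injections
  with displacements in [B] and disjoint images: both images would have
  measure one. *)
Lemma no_doubling (B : {fset G}) :
  ~ forall V : {fset G}, (2 * #|` V| <= #|` left_mul B V|)%N.
Proof.
move=> dbl; pose N (p : G * bool) := left_mul B [fset p.1]%fset.
have [S|phi [phi_inj phiN]] := hall_marriage (N := N).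
  pose V := [fset p.1 | p in S]%fset.
  have -> : neighbours N set0 S = left_mul B V.
    apply/fsetP => y; apply/neighboursP/left_mulP.
      case=> p pS; rewrite mem_edges_left =>
        /andP[/left_mulP[b [v [bB /fset1P-> ->]]] _].
      by exists b, p.1; split=> //; apply: in_imfset.
    case=> b [_ [bB /imfsetP[p /= pS ->] ->]]; exists p => //.
    rewrite mem_edges_left; apply/andP; split; last by apply/asboolP.
    by apply/left_mulP; exists b, p.1; rewrite fset11.
  apply: leq_trans (dbl V).
  have -> : (2 * #|` V| = size [seq (v, b) | v <- V, b <- [:: true; false]])%N.
    by rewrite size_allpairs mulnC.
  apply: uniq_leq_size => // -[v b] vbS; apply/allpairsP; exists (v, b).
  by split=> //; [apply/imfsetP; exists (v, b)|case: b {vbS}].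
have phi_mu b : mu [set phi (g, b) | g in setT] = 1%R.
  rewrite -muT; apply: (measure_bounded_displacement (s := B)) =>
    [g h /phi_inj[]//|g _].
  have /left_mulP[c [v [cB /fset1P-> ->]]] := phiN (g, b).
  by rewrite mulgK.
have := mu01 ([set phi (g, true) | g in setT] `|`
              [set phi (g, false) | g in setT]).
rewrite muU ?phi_mu; last first.
  by apply/seteqP; split=> // _ [[g _ <-] [h _ /phi_inj]].
by move=> /andP[_]; lra.
Qed.

(** Were every finite set expanded by the factor [1 + eps], a power of [A]
  would double it, since expansion factors multiply. *)
Lemma folner_of_measure (A : {fset G}) (eps : R) : (0 < eps)%R ->
  exists V, folner eps A V.
Proof.
move=> eps0; apply: contrapT => /forallNP noV.
have AV V : ((1 + eps) * #|` V|%:R <= #|` left_mul A V|%:R)%R.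
  by rewrite leNgt; apply/negP/noV.
have AnV n V : ((1 + eps) ^+ n * #|` V|%:R <= #|` iter n (left_mul A) V|%:R)%R.
  elim: n => [|n IHn]; first by rewrite expr0 mul1r.
  rewrite iterS; apply: le_trans (AV _); rewrite exprS -mulrA.
  by rewrite ler_pM2l //; lra.
(* Bernoulli's inequality makes the power exceed 2 once n > eps^-1. *)
have bern n : (1 + n%:R * eps <= (1 + eps) ^+ n)%R.
  elim: n => [|n IHn]; first by rewrite expr0 mul0r addr0.
  rewrite exprS -natr1; have := ler_wpM2l (_ : 0 <= 1 + eps)%R IHn.
  have : (0 <= n%:R * (eps * eps))%R by rewrite mulr_ge0 // mulr_ge0 // ltW.
  nra.
have [n n2] : exists n : nat, (2 <= (1 + eps) ^+ n)%R.
  exists (Num.bound eps^-1); apply: le_trans (bern _).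
  have := archi_boundP (_ : 0 <= eps^-1)%R;
    rewrite invr_ge0 ltW // => /(_ isT).
  by rewrite -(ltr_pM2r eps0) mulVf ?gt_eqF // => h; lra.
apply: (@no_doubling (iter n (left_mul A) [fset 1]%fset)) => V.
rewrite -iter_left_mul -(ler_nat R) natrM; apply: le_trans (AnV n V).
by rewrite ler_wpM2r.
Qed.

End AmenableFolner.

Lemma amenable_folner (R : realType) (G : groupType) :
  amenable R G -> has_folner_sets R G.
Proof.
by move=> [mu [mu01 muT muU muM]] A eps /andP[eps0 _];
  apply: folner_of_measure eps0.
Qed.

(** * Groups with Folner sets are amenable *)

Section UltraLimits.
Variables (R : realType) (I : Type) (U : set_system I) (UU : UltraFilter U).

Definition ultralim (u : I -> R) (l : R) : Prop :=
  forall e : R, (0 < e)%R -> \forall i \near U, (`|u i - l| < e)%R.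

(** The limit is the supremum of the eventual lower bounds: an ultrafilter
  decides for each real whether it is one. *)
Lemma ultralim_exists (u : I -> R) :
  (forall i, (0 <= u i <= 1)%R) -> exists l, ultralim u l.
Proof.
move=> u01; pose S := [set r : R | \forall i \near U, (r <= u i)%R].
have S0 : S 0%R by apply: nearW => i; case/andP: (u01 i).
have S1 : ubound S 1%R.
  move=> r /filter_ex[i ri]; apply: le_trans ri _; by case/andP: (u01 i).
exists (sup S) => e e0.
have supS : has_sup S by split; [exists 0%R|exists 1%R].
have [r Sr lr] := sup_adherent e0 supS.
have nSe : \forall i \near U, (u i < sup S + e)%R.
  have [Se|nSe] := in_ultra_setVsetC [set i | (sup S + e <= u i)%R] UU.
    have := ub_le_sup supS.2 Se; lra.
  by apply: filterS nSe => i /= /negP; rewrite -ltNge.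
apply: filterS2 Sr nSe => i ri ui; rewrite ltr_norml; lra.
Qed.

Lemma ultralim_le (u v : I -> R) l l' : ultralim u l -> ultralim v l' ->
  (forall e, (0 < e)%R -> \forall i \near U, (u i <= v i + e)%R) ->
    (l <= l')%R.
Proof.
move=> ul vl' uv; apply/ler_addgt0Pr => e e0; have e3 : (0 < e / 3)%R by lra.
have [i []] := filter_ex (filterI (filterI (ul _ e3) (vl' _ e3)) (uv _ e3)).
by move=> []; rewrite !ltr_norml; lra.
Qed.

Lemma ultralim_unique (u : I -> R) l l' :
  ultralim u l -> ultralim u l' -> l = l'.
Proof.
move=> ul ul'; apply/eqP; rewrite eq_le; apply/andP.
by split; apply: ultralim_le; eauto => e e0; apply: nearW => i; lra.
Qed.

Lemma ultralim_cst c : ultralim (fun=> c) c.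
Proof. by move=> e e0; apply: nearW => i; rewrite subrr normr0. Qed.

Lemma ultralimD (u v : I -> R) l l' :
  ultralim u l -> ultralim v l' -> ultralim (fun i => u i + v i)%R (l + l')%R.
Proof.
move=> ul vl' e e0; have e2 : (0 < e / 2)%R by lra.
by apply: filterS2 (ul _ e2) (vl' _ e2) => i; rewrite !ltr_norml; lra.
Qed.

End UltraLimits.

Section FolnerAmenable.
Variables (R : realType) (G : groupType).
Hypothesis Gfolner : has_folner_sets R G.

(** The Folner conditions themselves generate a filter on the finite subsets
  of the group, so no Folner sequence has to be chosen. *)
Definition folner_filter : set_system {fset G} :=
  [set P | exists A (eps : R), (0 < eps <= 1)%R /\
           forall V, folner eps A V -> P V].

Lemma folner_filter_proper : ProperFilter folner_filter.
Proof.
apply: Build_ProperFilter_ex => [P [A [eps [eps01 AP]]]|].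
  by have [V AV] := Gfolner A eps01; exists V; exact: AP.
split.
- by exists fset0, 1%R; rewrite ltr01 lexx.
- move=> P Q [A [e [e01 AP]]] [B [f [f01 BQ]]].
  exists (A `|` B)%fset, (Num.min e f).
  split=> [|V VAB]; first by rewrite lt_min ge_min; lra.
  have fol (C : {fset G}) (g : R) : {subset C <= (A `|` B)%fset} ->
      (Num.min e f <= g)%R -> folner g C V.
    move=> CAB eg.
    have sub : (#|` left_mul C V|%:R <=
                #|` left_mul (A `|` B)%fset V|%:R :> R)%R.
      by rewrite ler_nat; apply/fsubset_leq_card/fsubsetP/left_mulS.
    apply: le_lt_trans sub (lt_le_trans VAB _).
    by rewrite ler_wpM2r // lerD2l.
  split; [apply: AP|apply: BQ]; apply: fol; rewrite ?ge_min ?lexx ?orbT //.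
    by move=> x xA; rewrite in_fsetU xA.
  by move=> x xA; rewrite in_fsetU xA orbT.
- by move=> P Q PQ [A [e [e01 AP]]]; exists A, e; split=> // V /AP/PQ.
Qed.

Lemma folner_card_gt0 eps A (V : {fset G}) : @folner G R eps A V ->
  (0 < #|` V|)%N.
Proof.
by rewrite /folner lt0n; case: eqP => // ->; rewrite mulr0 ltNge ler0n.
Qed.

Definition part (B : set G) (V : {fset G}) : {fset G} :=
  [fset x in V | `[< B x >]]%fset.

Definition density (B : set G) (V : {fset G}) : R :=
  (#|` part B V|%:R / #|` V|%:R)%R.

Lemma density01 B V : (0 <= density B V <= 1)%R.
Proof.
apply/andP; split; first by rewrite divr_ge0.
have [->|V0] := eqVneq V fset0; first by rewrite /density cardfs0 invr0 mulr0.
rewrite ler_pdivrMr ?mul1r ?ler_nat ?fsubset_leq_card ?ltr0n ?cardfs_gt0 //.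
by apply/fsubsetP => x; rewrite !inE => /andP[].
Qed.

Lemma densityU (A B : set G) V : A `&` B = set0 ->
  density (A `|` B) V = (density A V + density B V)%R.
Proof.
move=> AB0; rewrite /density -mulrDl -natrD; congr (_%:R / _)%R.
have -> : part (A `|` B) V = (part A V `|` part B V)%fset.
  apply/fsetP => x; rewrite in_fsetU !inE -andb_orr; congr (_ && _).
  by rewrite -asbool_or.
rewrite -cardfsUI (_ : part A V `&` part B V = fset0)%fset ?cardfs0 ?addn0 //.
apply/fsetP => x; rewrite in_fsetI !inE; apply/negP.
move=> /andP[/andP[_ /asboolP Ax] /andP[_ /asboolP Bx]].
by have : (A `&` B) x by []; rewrite AB0.
Qed.

(** The part of [V] in [gB], translated back by [g^-1], lies in [B] and, up to
  fewer than [eps * #|V|] elements, in [V]. *)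
Lemma density_translate (g : G) (B : set G) (eps : R) (V : {fset G}) :
  folner eps [fset 1; g^-1]%fset V ->
  (density [set (g * b)%g | b in B] V <= density B V + eps)%R.
Proof.
move=> fol; have V0 : (0 < #|` V|%:R :> R)%R.
  by rewrite ltr0n (folner_card_gt0 fol).
rewrite /density ler_pdivrMr // mulrDl divfK ?gt_eqF //.
pose W := left_mul [fset 1; g^-1]%fset V.
have VW : (V `<=` W)%fset.
  by apply/fsubsetP => v vV; apply/left_mulP; exists 1, v;
    rewrite mul1g !inE eqxx.
pose Z : {fset G} :=
  [fset (g^-1 * x)%g | x in part [set (g * b)%g | b in B] V]%fset.
have cZ : #|` Z| = #|` part [set (g * b)%g | b in B] V|.
  by apply: card_imfset; exact: mulgI.
have ZS : (Z `<=` part B V `|` (W `\` V))%fset.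
  apply/fsubsetP => _ /imfsetP[x /= + ->];
    rewrite !inE => /andP[xV /asboolP[b Bb gb]].
  have bW : (g^-1 * x)%g \in W.
    by apply/left_mulP; exists g^-1, x; rewrite !inE eqxx orbT.
  rewrite bW andbT; case: (_ \in V) => //=; rewrite orbF.
  by apply/asboolP; rewrite -gb mulKg.
have := leq_trans (fsubset_leq_card ZS) (leq_card_fsetU _ _).
have WV : (#|` (W `\` V)%fset| + #|` V| = #|` W|)%N.
  by rewrite (cardfsDS VW) subnK //; exact: fsubset_leq_card.
rewrite cZ -(ler_nat R) natrD => h.
move: fol; rewrite /folner -/W -WV natrD; lra.
Qed.

(** The measure is the limit of the relative densities in Folner sets; that
  translations do not increase it is enough for invariance, as they are
  invertible. *)
Lemma folner_amenable : amenable R G.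
Proof.
have [U [UU FU]] := ultraFilterLemma folner_filter_proper.
have ULU (A : set G) : exists l, ultralim U (density A) l.
  exact/ultralim_exists/density01.
have [mu muE] := choice ULU.
have mu_le (g : G) (B : set G) : (mu [set (g * b)%g | b in B] <= mu B)%R.
  apply: ultralim_le (muE _) (muE _) _ => e e0; apply: FU.
  exists [fset 1; g^-1]%fset, (Num.min e 1)%R; split=> [|V /density_translate].
    by rewrite lt_min ge_min; lra.
  by move=> /(_ B) /le_trans; apply; rewrite lerD2l ge_min lexx.
exists mu; split.
- move=> A; apply/andP; split;
    [apply: ultralim_le (ultralim_cst _ _) (muE A) _
    |apply: ultralim_le (muE A) (ultralim_cst _ _) _] => e e0;
      apply: nearW => V;
    have /andP[] := density01 A V; lra.
- apply: ultralim_unique (muE _) _ => e e0; apply: FU.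
  exists fset0, 1%R; split; first by rewrite ltr01 lexx.
  move=> V /folner_card_gt0 V0; rewrite /density (_ : part setT V = V).
    by rewrite divff ?subrr ?normr0 // pnatr_eq0 -lt0n.
  by apply/fsetP => x; rewrite !inE (_ : `[< _ >] = true) ?andbT //;
    apply/asboolP.
- move=> A B AB0; apply: ultralim_unique (muE _) _.
  rewrite (_ : density _ = fun V => (density A V + density B V)%R).
    exact: ultralimD.
  by apply/funext => V; exact: densityU.
move=> g A; apply/eqP; rewrite eq_le mu_le /=.
have := mu_le g^-1 [set (g * a)%g | a in A]; rewrite image_comp.
rewrite (_ : (fun x => _) \o _ = id) ?image_id //.
by apply/funext => x /=; rewrite mulKg.
Qed.

End FolnerAmenable.

(** * Images of Folner sets *)

Section LevelSets.
Variables (G H : groupType) (f : G -> H).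
Hypothesis fM : {morph f : x y / x * y}.
Implicit Types A V : {fset G}.

(** The image of a Folner set under a homomorphism need not be a Folner set,
  but the image counted with multiplicities behaves like one, and it is the
  sum of its level sets. *)
Definition fiber_card V (h : H) : nat := \sum_(v <- V | f v == h) 1.

Definition level_set V (t : nat) : {fset H} :=
  [fset h in [fset f v | v in V] | (t < fiber_card V h)%N]%fset.

Lemma fiber_cardE V h : fiber_card V h = #|` [fset v in V | f v == h]%fset|.
Proof. by rewrite card_fset_sum1 big_fset. Qed.

Lemma leq_fiber_card V h : (fiber_card V h <= #|` V|)%N.
Proof. by rewrite fiber_cardE fsubset_leq_card // fset_sub. Qed.

Lemma sum_level_set V T : (#|` V| <= T)%N ->
  (#|` V| = \sum_(t < T) #|` level_set V t|)%N.
Proof.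
move=> VT; rewrite card_fset_sum1 (partition_big_imfset _ f).
transitivity (\sum_(h <- [fset f v | v in V]%fset)
                \sum_(t < T | (t < fiber_card V h)%N) 1)%N.
  apply: eq_bigr => h _; rewrite -/(fiber_card V h).
  have := leq_trans (leq_fiber_card V h) VT; move: (fiber_card _ _) => m mT.
  by rewrite -(big_ord_widen T (fun=> 1%N) mT) sum1_card card_ord.
rewrite (eq_bigr (fun h => \sum_(t < T) (t < fiber_card V h)%N)); last first.
  by move=> h _; rewrite big_mkcond.
rewrite exchange_big; apply: eq_bigr => t _.
by rewrite card_fset_sum1 big_fset [RHS]big_mkcond.
Qed.

Lemma leq_card_level_set V t : (#|` level_set V t| <= #|` V|)%N.
Proof.
have fV : (#|` [fset f v | v in V]%fset| <= #|` V|)%N.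
  exact: leq_imfset_card.
by apply: leq_trans fV; apply/fsubset_leq_card/fset_sub.
Qed.

(** Multiplication by [a] maps the fiber over [h] injectively into the fiber
  over [f a * h]. *)
Lemma left_mul_level_set A V t :
  (left_mul [fset f a | a in A] (level_set V t) `<=`
   level_set (left_mul A V) t)%fset.
Proof.
apply/fsubsetP => _ /left_mulP[_ [h [/imfsetP[a /= aA ->] + ->]]].
rewrite !inE => /andP[/imfsetP[v /= vV ->] tV]; apply/andP; split.
  by rewrite -fM in_imfset //; apply/left_mulP; exists a, v.
apply: leq_trans tV _; rewrite !fiber_cardE.
have <- : #|` [fset (a * u)%g | u in [fset u in V | f u == f v]]%fset| =
          #|` [fset u in V | f u == f v]%fset|.
  by apply: card_imfset; exact: mulgI.
apply/fsubset_leq_card/fsubsetP => _ /imfsetP[u /= + ->];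
  rewrite !inE => /andP[uV /eqP uv].
by rewrite fM uv eqxx andbT; apply/left_mulP; exists a, u.
Qed.

(** Some level set is a Folner set, as otherwise summing over the levels
  would contradict that [V] is one. *)
Lemma folner_image (R : realType) (eps : R) A V : folner eps A V ->
  exists2 W : {fset H}, (#|` W| <= #|` V|)%N &
    folner eps [fset f a | a in A]%fset W.
Proof.
move=> fol; apply: contrapT => noW.
pose T := (#|` left_mul A V| + #|` V|)%N.
suff : (((1 + eps) * #|` V|%:R) <= #|` left_mul A V|%:R)%R.
  by rewrite leNgt => /negP; apply.
rewrite (@sum_level_set V T) ?leq_addl //.
rewrite (@sum_level_set (left_mul A V) T) ?leq_addr //.
rewrite !natr_sum mulr_sumr; apply: ler_sum => t _.
apply: le_trans
  (_ : _ <= #|` left_mul [fset f a | a in A]%fset (level_set V t)|%:R)%R _.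
  rewrite leNgt; apply/negP => folt; apply: noW.
  by exists (level_set V t); first exact: leq_card_level_set.
by rewrite ler_nat fsubset_leq_card // left_mul_level_set.
Qed.

End LevelSets.

(** * Products and finitely generated subgroups *)

Section ProductGroup.
Variables (I : Type) (H : I -> groupType).

Definition product_group : Type := forall i, H i.

HB.instance Definition _ := gen_eqMixin product_group.
HB.instance Definition _ := gen_choiceMixin product_group.

Implicit Types x y z : product_group.

Definition product_one : product_group := fun=> 1.
Definition product_mul x y : product_group := fun i => x i * y i.
Definition product_inv x : product_group := fun i => (x i)^-1.

Lemma product_mulA : associative product_mul.
Proof.
by move=> x y z; apply: functional_extensionality_dep => i; exact: mulgA.
Qed.

Lemma product_mul1 : left_id product_one product_mul.
Proof.
by move=> x; apply: functional_extensionality_dep => i; exact: mul1g.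
Qed.

Lemma product_mulr1 : right_id product_one product_mul.
Proof.
by move=> x; apply: functional_extensionality_dep => i; exact: mulg1.
Qed.

Lemma product_mulV : left_inverse product_one product_inv product_mul.
Proof.
by move=> x; apply: functional_extensionality_dep => i; exact: mulVg.
Qed.

Lemma product_mulrV : right_inverse product_one product_inv product_mul.
Proof.
by move=> x; apply: functional_extensionality_dep => i; exact: mulgV.
Qed.

HB.instance Definition _ :=
  isGroup.Build product_group product_mulA product_mul1 product_mulr1
    product_mulV product_mulrV.

End ProductGroup.

Section GeneratedGroup.
Variables (G : groupType) (S : seq G).

Definition generated : {pred G} := fun x =>
  `[< forall K : {pred G}, group_closed K -> {subset S <= K} -> x \in K >].

Lemma generated_closed : group_closed generated.
Proof.
split=> [|x y /asboolP Sx /asboolP Sy]; apply/asboolP => K KG SK;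
  first exact: KG.1.
by apply: KG.2; [exact: Sx|exact: Sy].
Qed.

Lemma sub_generated x : x \in S -> x \in generated.
Proof. by move=> xS; apply/asboolP => K _; apply. Qed.

Definition generated_group : Type := {x : G | generated x}.

HB.instance Definition _ := SubChoice.on generated_group.
HB.instance Definition _ :=
  SubChoice_isSubGroup.Build G generated generated_group generated_closed.

Definition generators : seq generated_group := pmap insub S.

Lemma map_generators : map val generators = S.
Proof.
rewrite /generators pmap_filter; last exact: insubK.
apply/all_filterP/allP => x xS; rewrite isSome_insub; exact: sub_generated.
Qed.

Lemma val_generatedM : {morph (val : generated_group -> G) : x y / x * y}.
Proof. exact: valM. Qed.

Lemma generated_group_fg : finitely_generated generated_group.
Proof.
exists generators => K KG SK x.
pose K' : {pred G} := fun y =>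
  `[< exists2 u : generated_group, val u = y & u \in K >].
have : val x \in K'.
  have /asboolP := valP x; apply.
    split; first by apply/asboolP; exists 1; [exact: val1|exact: KG.1].
    move=> _ _ /asboolP[u <- uK] /asboolP[v <- vK]; apply/asboolP.
    exists (u * v^-1); last exact: KG.2.
    by rewrite val_generatedM (morphismV val_generatedM).
  move=> y; rewrite -map_generators => /mapP[u uS ->]; apply/asboolP.
  by exists u; rewrite // SK.
by case/asboolP => u /val_inj ->.
Qed.

End GeneratedGroup.

Lemma residually_finite_sub (G H : groupType) (f : G -> H) :
  {morph f : x y / x * y} -> injective f -> residually_finite H ->
  residually_finite G.
Proof.
move=> fM f_inj Hrf g g1; have [|F [h hg]] := Hrf (f g).
  by rewrite -(morphism1 fM) => /f_inj.
have hfM : {morph h \o f : x y / x * y} by move=> x y /=; rewrite fM gmulfM.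
by exists F, (bundle_morphism hfM).
Qed.

Lemma residually_finite_product (I : Type) (H : I -> groupType) :
  (forall i, residually_finite (H i)) -> residually_finite (product_group H).
Proof.
move=> Hrf g g1; have [i gi] : exists i, g i <> 1.
  apply: contrapT => /forallNP gi; apply: g1.
  by apply: functional_extensionality_dep => i; apply: contrapT; exact: gi.
have [F [h hg]] := Hrf i _ gi.
have hM : {morph (fun x : product_group H => h (x i)) : x y / x * y}.
  by move=> x y; rewrite -gmulfM.
by exists F, (bundle_morphism hM).
Qed.

(** * Folner sets of bounded size *)

Definition word_identity (G : groupType) k (w : free_group 'I_k) : Prop :=
  forall g : 'I_k -> G, word_value g w = 1.

Lemma word_identity_sub (G H : groupType) (f : G -> H) k
    (w : free_group 'I_k) :
  {morph f : x y / x * y} -> injective f ->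
  word_identity H w -> word_identity G w.
Proof.
move=> fM f_inj Hw g; apply: f_inj.
by rewrite (morph_word_value fM) (morphism1 fM) Hw.
Qed.

Lemma word_identity_product (I : Type) (H : I -> groupType) k
    (w : free_group 'I_k) :
  (forall i, word_identity (H i) w) -> word_identity (product_group H) w.
Proof.
move=> Hw g; apply: functional_extensionality_dep => i.
by rewrite (morph_word_value (f := fun x : product_group H => x i)) //;
  exact: Hw.
Qed.

(** If no bound [N] worked, there would be for each [N] a group [H N] with a
  tuple that has no Folner set of size at most [N].  The tuples of all these
  groups together are a tuple in the product of the [H N]; it generates a
  group that is again residually finite and satisfies the same identity, hence
  has a Folner set [V].  With [N] the size of [V], projecting [V] to [H N] is
  a contradiction.  That the generators are finitely many elements of the
  product is where the common length [n] of the tuples matters. *)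
Lemma uniform_folner (R : realType) k (w : free_group 'I_k) n (eps : R) :
    w <> 1 -> (0 < eps <= 1)%R ->
    (forall G : groupType, finitely_generated G -> residually_finite G ->
       satisfies_nontrivial_identity G -> has_folner_sets R G) ->
  exists N, forall H : groupType, residually_finite H -> word_identity H w ->
    forall s : seq H, size s = n ->
    exists2 V : {fset H}, (#|` V| <= N)%N & folner eps [fset x in s]%fset V.
Proof.
move=> w1 eps01 folG; apply: contrapT => /forallNP noN.
have : forall N, exists p : {H : groupType & seq H},
    [/\ residually_finite (projT1 p), word_identity (projT1 p) w,
        size (projT2 p) = n &
        forall V : {fset projT1 p}, (#|` V| <= N)%N ->
          ~ folner eps [fset x in projT2 p]%fset V].
  move=> N; have /existsNP[H] := noN N.
  move=> /not_implyP[Hrf /not_implyP[Hw /existsNP[s /not_implyP[sn nV]]]].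
  by exists (existT _ H s); split=> // V VN folV; apply: nV; exists V.
move=> /choice[p pP]; pose H N := projT1 (p N).
pose S : seq (product_group H) :=
  [seq (fun N => nth 1 (projT2 (p N)) j) | j <- iota 0 n].
pose Gam := generated_group S.
have ProdRF : residually_finite (product_group H).
  by apply: residually_finite_product => N; case: (pP N).
have Prodw : word_identity (product_group H) w.
  by apply: word_identity_product => N; case: (pP N).
have valGM : {morph (val : Gam -> product_group H) : x y / x * y}.
  exact: val_generatedM.
have folGam : has_folner_sets R Gam.
  apply: folG; first exact: generated_group_fg.
    exact: residually_finite_sub valGM val_inj ProdRF.
  by exists k, w; split=> //; exact: word_identity_sub valGM val_inj Prodw.
have [V folV] := folGam [fset x in generators S]%fset eps eps01.
(* The bound to be violated is the size of the Folner set just obtained. *)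
pose N := #|` V|; have [_ _ pn nV] := pP N.
pose f (x : Gam) : H N := val x N.
have fM : {morph f : x y / x * y} by move=> x y; rewrite /f valGM.
have [W WV folW] := folner_image fM folV.
apply: (nV W WV); move: folW; set A := [fset f a | a in _]%fset.
suff -> : A = [fset x in projT2 (p N)]%fset by [].
apply/fsetP => y; apply/imfsetP/idP => /=.
  case=> x; rewrite !inE => xS ->.
  have /mapP[j] : val x \in S by move: (map_f val xS); rewrite map_generators.
  by rewrite mem_iota add0n -pn => jn xE; rewrite /f xE mem_nth.
rewrite inE => /(nthP 1)[j]; rewrite pn => jn <-.
have : (fun N => nth 1 (projT2 (p N)) j) \in S by rewrite map_f // mem_iota.
rewrite -{1}(map_generators S) => /mapP[x xS xE]; exists x; rewrite ?inE //.
by rewrite /f -xE.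
Qed.

(** * Formulas with finitely many parameters are countable *)

Section FormulaCode.
Variables (C : Type) (e : C -> nat) (d : nat -> option C).
Hypothesis eK : pcancel e d.

Import GenTree.

(** Terms and formulas are coded by labelled trees, which are countable.
  Decoding, rather than a direct proof of injectivity, avoids case analysis
  on two formulas with the same number of free variables. *)
Fixpoint term_tree n (t : term C n) : tree nat :=
  match t with
  | Var i => Node 0 [:: Leaf (i : nat)]
  | Cst a => Node 1 [:: Leaf (e a)]
  | One => Node 2 [::]
  | Mul t1 t2 => Node 3 [:: term_tree t1; term_tree t2]
  | Defs.Inv t1 => Node 4 [:: term_tree t1]
  end.

Fixpoint tree_term n (t : tree nat) : option (term C n) :=
  match t with
  | Node 0 [:: Leaf i] => omap (@Var C n) (insub i)
  | Node 1 [:: Leaf a] => omap (@Cst C n) (d a)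
  | Node 2 [::] => Some (One C n)
  | Node 3 [:: t1; t2] =>
      obind (fun u => omap (Mul u) (tree_term n t2)) (tree_term n t1)
  | Node 4 [:: t1] => omap (@Defs.Inv C n) (tree_term n t1)
  | _ => None
  end.

Lemma term_treeK n : pcancel (@term_tree n) (@tree_term n).
Proof.
elim=> [i|a||t1 IH1 t2 IH2|t1 IH1] //=; rewrite ?valK ?eK //= ?IH1 //= IH2 //.
Qed.

Fixpoint formula_tree n (phi : formula C n) : tree nat :=
  match phi with
  | Eq _ t1 t2 => Node 0 [:: term_tree t1; term_tree t2]
  | Bot _ => Node 1 [::]
  | Imp _ phi1 phi2 => Node 2 [:: formula_tree phi1; formula_tree phi2]
  | All _ phi1 => Node 3 [:: formula_tree phi1]
  end.

Fixpoint tree_formula (t : tree nat) n : option (formula C n) :=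
  match t with
  | Node 0 [:: t1; t2] =>
      obind (fun u => omap (Eq u) (tree_term n t2)) (tree_term n t1)
  | Node 1 [::] => Some (Bot C n)
  | Node 2 [:: t1; t2] =>
      obind (fun phi => omap (Imp phi) (tree_formula t2 n)) (tree_formula t1 n)
  | Node 3 [:: t1] => omap (@All C n) (tree_formula t1 n.+1)
  | _ => None
  end.

Lemma formula_treeK n (phi : formula C n) :
  tree_formula (formula_tree phi) n = Some phi.
Proof.
elim: phi => {n} [n t1 t2|n|n phi1 IH1 phi2 IH2|n phi1 IH1] //=.
- by rewrite !term_treeK.
- by rewrite IH1 /= IH2.
- by rewrite IH1.
Qed.

End FormulaCode.

Lemma formula_code (C : Type) (e : C -> nat) n : injective e ->
  exists code : formula C n -> nat, injective code.
Proof.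
move=> e_inj.
have /choice[d dP] (m : nat) :
    exists o : option C, forall a, e a = m -> o = Some a.
  have [[a am]|na] := pselect (exists a, e a = m).
    by exists (Some a) => b bm; congr Some; apply: e_inj; rewrite am bm.
  by exists None => a am; case: na; exists a.
have eK : pcancel e d by move=> a; exact: dP.
exists (fun phi => choice.pickle (formula_tree e phi)).
move=> phi psi /(pcan_inj choice.pickleK) E.
by have := formula_treeK eK phi; rewrite E formula_treeK => // -[].
Qed.

Lemma formula_code_finite (G : groupType) (A : set G) n : finite_set A ->
  exists code : formula A n -> nat, injective code.
Proof.
move=> /finite_set_countable/countable_injP[f f_inj].
apply: (@formula_code _ (fun a : A => f (val a))) => a b /f_inj ab.
by apply/val_inj/ab; rewrite inE; exact: set_valP.
Qed.

(** * The theorem of Los *)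

Lemma pi_choice (I : Type) (T : I -> Type) (P : forall i, T i -> Prop) :
  (forall i, exists x, P i x) -> exists f : forall i, T i, forall i, P i (f i).
Proof.
by move=> Pex; exists (fun i => projT1 (cid (Pex i))) => i; case: cid.
Qed.

Section Los.
Variables (I : Type) (U : set_system I) (UU : UltraFilter U).
Variable F : I -> groupType.
Local Notation K := (ultraproduct U F).
Local Notation class := (@ultra_class I U UU F).

Section Constants.
Variables (C : Type) (c : forall i, C -> F i).

(** Constants and variables are interpreted in the ultraproduct by the classes
  of given families.  Any interpretation has this form, and extending a
  valuation becomes a componentwise operation. *)
Definition class_const : C -> K := fun a => class (fun i => c i a).
Definition class_env n (v : forall i, 'I_n -> F i) : 'I_n -> K :=
  fun j => class (fun i => v i j).

Lemma eval_ultraproduct n (v : forall i, 'I_n -> F i) (t : term C n) :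
  eval class_const (class_env v) t = class (fun i => eval (c i) (v i) t).
Proof.
elim: t => [j|a||t1 IH1 t2 IH2|t1 IH1] //=.
  by rewrite IH1 IH2; exact: ultra_mulE.
by rewrite IH1; exact: ultra_invE.
Qed.

Lemma class_env_cons n (f : forall i, F i) (v : forall i, 'I_n -> F i) :
  env_cons (class f) (class_env v) = class_env (fun i => env_cons (f i) (v i)).
Proof.
by apply/funext => j; rewrite /env_cons /class_env; case: unlift.
Qed.

(** Negation is where the ultrafilter property enters: it decides the
  hypothesis of an implication, and if a universal formula fails almost
  everywhere, counterexamples chosen componentwise form one in the
  ultraproduct. *)
Theorem holds_ultraproduct n (phi : formula C n) (v : forall i, 'I_n -> F i) :
  holds class_const phi (class_env v) <->
  \forall i \near U, holds (c i) phi (v i).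
Proof.
elim: phi v => {n} [n t1 t2|n|n phi1 IH1 phi2 IH2|n phi1 IH1] v /=.
- by rewrite !eval_ultraproduct; exact: ultra_classP.
- by split=> // /filter_ex[].
- split=> [h|h /IH1 h1]; last first.
    by apply/IH2; apply: filterS2 h h1 => i; apply.
  have [h1|h1] := in_ultra_setVsetC [set i | holds (c i) phi1 (v i)] UU.
    by have /h/IH2 : holds class_const phi1 (class_env v) by [exact/IH1];
      apply: filterS.
  by apply: filterS h1 => i /= nh1 /nh1.
- split=> [h|h x].
    have [//|nh] := in_ultra_setVsetC
      [set i | forall x, holds (c i) phi1 (env_cons x (v i))] UU.
    have /pi_choice[f fP] i : exists x : F i,
        ~ (forall x, holds (c i) phi1 (env_cons x (v i))) ->
        ~ holds (c i) phi1 (env_cons x (v i)).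
      by have [?|/existsNP[x nx]] :=
        pselect (forall x, holds (c i) phi1 (env_cons x (v i)));
          [exists 1|exists x].
    have := h (class f); rewrite class_env_cons => /IH1 hf.
    by have [i [/= hi nhi]] := filter_ex (filterI hf nh); case: (fP i nhi).
  rewrite -[x]ultra_classK class_env_cons; apply/IH1.
  by apply: filterS h => i; apply.
Qed.

End Constants.

Lemma class_envK n (v : 'I_n -> K) : class_env (fun i j => repr (v j) i) = v.
Proof. by apply/funext => j; exact: ultra_classK. Qed.

Lemma satisfies_ultraproduct (phi : sentence) :
  satisfies K phi <-> \forall i \near U, satisfies (F i) phi.
Proof.
rewrite /satisfies -(class_envK (fun=> 1)).
have -> : of_void K = class_const (fun i => of_void (F i)).
  by apply/funext => -[].
rewrite holds_ultraproduct; split; apply: filterS => i;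
  by rewrite (_ : (fun j : 'I_0 => _) = (fun=> 1)) //; apply/funext => -[].
Qed.

End Los.

(** * Ultraproducts of finite groups are saturated and pseudofinite *)

(** If no point works, let [k x] be a satisfiable condition that [x] violates.
  The [x] for which [k x] is largest gives a condition satisfied by some [y],
  and then [y] satisfies the weaker condition [k y] too. *)
Lemma uniform_witness (T : finType) (x0 : T) (P : nat -> T -> Prop) :
    (forall m n x, (m <= n)%N -> P n x -> P m x) ->
  exists x, forall n, (exists y, P n y) -> P n x.
Proof.
move=> Pmono; apply: contrapT => /forallNP noX.
have /choice[k kP] x : exists n, (exists y, P n y) /\ ~ P n x.
  by have /existsNP[n /not_implyP[]] := noX x; exists n.
pose x := [arg max_(x > x0) k x]%N.
have kx y : (k y <= k x)%N by rewrite /x; case: arg_maxnP => // z _; exact.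
have [[y Py] _] := kP x; have [_] := kP y; apply.
exact: Pmono (kx y) Py.
Qed.

(** Enumerate the formulas of the type.  In each factor, [uniform_witness]
  yields a tuple satisfying every initial segment of the type that is
  satisfiable there; by the theorem of Los each initial segment is
  satisfiable in almost all factors.  Finiteness of the factors matters where
  all initial segments are satisfiable, but perhaps not by the same tuple. *)
Theorem ultraproduct_saturated (I : Type) (U : set_system I)
    (UU : UltraFilter U) (F : I -> finGroupType) :
  aleph0_saturated (ultraproduct U (fun i => F i)).
Proof.
move=> A n p /(formula_code_finite n)[code code_inj] ptype.
pose c i (a : A) : F i := repr (val a) i.
have cE : (val : A -> _) = class_const UU (F := fun i => F i) c.
  by apply/funext => a; rewrite /class_const ultra_classK.
pose P i k (v : {ffun 'I_n -> F i}) :=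
  forall phi, p phi -> (code phi < k)%N -> holds (c i) phi v.
have /pi_choice[v vP] i : exists v, forall k,
    (exists v', P i k v') -> P i k v.
  apply: uniform_witness => [|k l v kl Pl phi pphi phik];
    first exact: [ffun=> 1].
  by apply: Pl pphi (leq_trans phik kl).
(* By Los the formulas with code below [k], being finitely many, are
   satisfied together in almost all factors. *)
have XU k : \forall i \near U, exists v, P i k v.
  pose q := [set phi | p phi /\ (code phi < k)%N].
  have [|phi []//|w wq] := ptype q.
    apply: (@sub_finite_set _ _ (code @^-1` `I_k)); first by move=> phi [].
    by apply: finite_preimage => [phi psi _ _ /code_inj|]; [|exact: finite_II].
  have : \forall i \near U, forall phi, q phi ->
      holds (c i) phi (fun j => repr (w j) i).
    have : forall l, \forall i \near U, forall phi, q phi ->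
        (code phi < l)%N -> holds (c i) phi (fun j => repr (w j) i).
      elim=> [|l IHl]; first by apply: nearW.
      have [[phi [qphi phil]]|nphi] :=
        pselect (exists phi, q phi /\ code phi = l).
        have : holds (class_const UU (F := fun i => F i) c) phi
            (class_env UU (fun i j => repr (w j) i)).
          by rewrite class_envK -cE; exact: wq.
        move=> /holds_ultraproduct.
        apply: filterS2 IHl => i IHi hphi psi qpsi; rewrite ltnS leq_eqVlt.
        move=> /orP[/eqP psil|psil]; last exact: IHi.
        by move: psil; rewrite -phil => /code_inj->.
      apply: filterS IHl => i IHi psi qpsi; rewrite ltnS leq_eqVlt.
      by move=> /orP[/eqP psil|psil]; [case: nphi; exists psi|exact: IHi].
    by move=> /(_ k); apply: filterS => i h phi [pphi phik]; apply: h.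
  apply: filterS => i h; exists [ffun j => repr (w j) i] => phi pphi phik.
  have -> : ([ffun j => repr (w j) i] : {ffun _ -> _}) =
            (fun j => repr (w j) i) :> (_ -> _).
    by apply: functional_extensionality_dep => j; rewrite ffunE.
  exact: h.
exists (class_env UU (fun i j => v i j)) => phi pphi; rewrite cE.
apply/holds_ultraproduct; apply: filterS (XU (code phi).+1) => i /vP; exact.
Qed.

Lemma ultraproduct_pseudofinite (I : Type) (U : set_system I)
    (UU : UltraFilter U) (F : I -> finGroupType) :
  pseudofinite (ultraproduct U (fun i => F i)).
Proof. by move=> phi Fphi; apply/satisfies_ultraproduct; apply: nearW. Qed.

(** * Residually finite groups inside ultraproducts *)

(** Choosing representatives of the right cosets of [G] in [H] gives a map
  [r] from [H] to [G] that commutes with left translations by [G]; the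
  invariant measure is pushed forward along it. *)
Lemma amenable_sub (R : realType) (G H : groupType) (f : G -> H) :
  {morph f : x y / x * y} -> injective f -> amenable R H -> amenable R G.
Proof.
move=> fM f_inj [mu [mu01 muT muU muM]].
pose coset_rep x := xget 1 [set y | exists g, y = f g * x].
have repE x : exists g, x = f g * coset_rep x.
  have [g gE] : exists g, coset_rep x = f g * x.
    apply: (@xgetI _ 1 [set y | exists g, y = f g * x] x).
    by exists 1; rewrite (morphism1 fM) mul1g.
  by exists g^-1; rewrite gE (morphismV fM) mulKg.
have rep_coset g x : coset_rep (f g * x) = coset_rep x.
  congr xget; apply/seteqP; split=> y [h ->].
    by exists (h * g); rewrite fM mulgA.
  by exists (h * g^-1); rewrite fM (morphismV fM) mulgA mulgVK.
have [r rE] := choice repE.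
have rM g x : r (f g * x) = g * r x.
  apply: f_inj; apply: (mulIg (coset_rep x)).
  by rewrite -{1}(rep_coset g) -rE fM -mulgA -rE.
exists (fun A => mu (r @^-1` A)); split=> [A|||g A].
- exact: mu01.
- by rewrite preimage_setT.
- move=> A B AB0.
  by rewrite preimage_setU muU // -preimage_setI AB0 preimage_set0.
rewrite -[RHS](muM (f g)); congr mu; apply/seteqP; split=> x.
  move=> /= [a Aa ax].
  exists (f g^-1 * x); last by rewrite (morphismV fM) mulVKg.
  by rewrite /= rM -ax mulKg.
by move=> [y Ay <-]; exists (r y); rewrite ?rM.
Qed.

Lemma word_identity_surj (G H : groupType) (f : G -> H) k
    (w : free_group 'I_k) :
    {morph f : x y / x * y} -> (forall y, exists x, f x = y) ->
  word_identity G w -> word_identity H w.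
Proof.
move=> fM /choice[r rK] Gw g.
have -> : g = f \o (fun j => r (g j)) by apply/funext => j; rewrite /= rK.
by rewrite -(morph_word_value fM) Gw (morphism1 fM).
Qed.

Lemma word_identity_ultraproduct (I : Type) (U : set_system I)
    (UU : UltraFilter U) (F : I -> groupType) k (w : free_group 'I_k) :
  (forall i, word_identity (F i) w) -> word_identity (ultraproduct U F) w.
Proof.
move=> /word_identity_product; apply: (word_identity_surj
  (G := product_group F) (H := ultraproduct U F) (f := @ultra_class I U UU F)).
  by move=> x y; exact/esym/ultra_mulE.
by move=> x; exists (repr x); exact: ultra_classK.
Qed.

Lemma residually_finite_seq (G : groupType) (s : seq G) :
  residually_finite G ->
  exists (F : finGroupType) (f : G -> F), {morph f : x y / x * y} /\
    forall x, x \in s -> x <> 1 -> f x <> 1.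
Proof.
move=> Grf; elim: s => [|y s [F [f [fM fs]]]].
  by exists {perm 'I_1}, (fun=> 1); split=> // x y; rewrite mulg1.
have [->|y1] := eqVneq y 1.
  exists F, f; split=> // x; rewrite inE => /predU1P[->//|]; exact: fs.
have [F' [f' f'y]] := Grf y (elimN eqP y1).
exists (F * F')%type, (fun x => (f x, f' x)); split=> [x z|x].
  by rewrite fM gmulfM.
rewrite inE => /predU1P[->|xs] x1 [fx f'x]; first exact: f'y.
exact: fs x1 fx.
Qed.

Section Image.
Variables (G : groupType) (F : finGroupType) (f : G -> F).
Hypothesis fM : {morph f : x y / x * y}.

(** Replacing a finite group by the image of [G] makes it inherit the
  identities of [G]. *)
Definition image_set : {set F} := [set y : F | `[< exists x, f x = y >]]%SET.

Lemma image_setP y : reflect (exists x, f x = y) (y \in image_set).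
Proof. by rewrite inE; exact: asboolP. Qed.

Lemma image_group_set : group_set image_set.
Proof.
apply/group_setP; split=> [|_ _ /image_setP[x <-] /image_setP[y <-]].
  by apply/image_setP; exists 1; exact: morphism1.
by apply/image_setP; exists (x * y).
Qed.

Definition image_group : {group F} := Group image_group_set.

Lemma image_quotient : exists h : G -> [subg image_group],
  [/\ {morph h : x y / x * y}, forall y, exists x, h x = y
    & forall x, f x <> 1 -> h x <> 1].
Proof.
have fin x : f x \in image_group by apply/image_setP; exists x.
exists (fun x => subg image_group (f x)); split.
- by move=> x y; rewrite fM subgM.
- move=> y; have /image_setP[x xy] := subgP y; exists x.
  by rewrite xy sgvalK.
- by move=> x fx /(congr1 sgval); rewrite subgK.
Qed.

End Image.

(** The factors are indexed by the finite sequences of elements of [G], and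
  the ultrafilter makes each element of [G] belong to almost all of them, so
  that it survives in almost all factors. *)
Lemma residually_finite_ultraproduct (G : groupType) k (w : free_group 'I_k) :
    residually_finite G -> word_identity G w ->
  exists (I : Type) (U : set_system I) (UU : UltraFilter U)
      (F : I -> finGroupType) (f : G -> ultraproduct U (fun i => F i)),
    [/\ {morph f : x y / x * y}, injective f
      & forall i, word_identity (F i) w].
Proof.
move=> Grf Gw.
have /pi_choice[F /pi_choice[f fP]] (s : seq G) :
    exists (F : finGroupType) (f : G -> F),
    [/\ {morph f : x y / x * y}, word_identity F w &
        forall x, x \in s -> x <> 1 -> f x <> 1].
  have [F [f [fM fs]]] := residually_finite_seq s Grf.
  have [h [hM h_surj hf]] := image_quotient fM.
  exists (subg_of (image_group fM)), h; split=> //.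
    exact: word_identity_surj hM h_surj Gw.
  by move=> x xs x1; apply/hf/fs.
pose Fil : set_system (seq G) :=
  [set P | exists s : seq G, forall t : seq G, {subset s <= t} -> P t].
have FilP : ProperFilter Fil.
  apply: Build_ProperFilter_ex => [P [s sP]|]; first by exists s; exact: sP.
  split; first by exists [::].
    move=> P Q [s sP] [t tQ]; exists (s ++ t) => r str; split.
      by apply: sP => x xs; apply: str; rewrite mem_cat xs.
    by apply: tQ => x xs; apply: str; rewrite mem_cat xs orbT.
  by move=> P Q PQ [s sP]; exists s => t /sP/PQ.
have [U [UU FU]] := ultraFilterLemma FilP.
pose h (x : G) : ultraproduct U (fun i => F i) :=
  @ultra_class _ U UU (fun i => F i) (fun i => f i x).
have hM : {morph h : x y / x * y}.
  move=> x y; rewrite [RHS]ultra_mulE; congr ultra_class.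
  by apply: functional_extensionality_dep => i; case: (fP i).
exists (seq G), U, UU, F, h; split=> //; last by move=> i; case: (fP i).
apply: (morphism_inj hM) => x /ultra_classP hx; apply: contrapT => x1.
have Ux : U [set t | x \in t].
  by apply: FU; exists [:: x] => t; apply; rewrite mem_head.
have [t [ft xt]] := filter_ex (filterI hx Ux).
by case: (fP t) => _ _ /(_ x xt x1).
Qed.

Theorem ultraproduct_alternative_amenable (R : realType) :
    (forall (I : Type) (U : set_system I) (UU : UltraFilter U)
       (F : I -> finGroupType),
       contains_free_nonabelian (ultraproduct U (fun i => F i)) \/
       amenable R (ultraproduct U (fun i => F i))) ->
  forall G : groupType, residually_finite G ->
    satisfies_nontrivial_identity G -> amenable R G.
Proof.
move=> alt G Grf [k [w [w1 Gw]]].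
have [I [U [UU [F [f [fM f_inj Fw]]]]]] :=
  residually_finite_ultraproduct Grf Gw.
have [/free_nonabelian_no_identity[]|] := alt I U UU F.
  by exists k, w; split=> //; exact: word_identity_ultraproduct.
exact: amenable_sub fM f_inj.
Qed.

(** * Saturated groups without free subgroups satisfy an identity *)

Section WordTerm.
Variables (C : Type) (n : nat).

Definition letter_term (a : 'I_n * bool) : term C n :=
  if a.2 then Var C a.1 else Defs.Inv (Var C a.1).

Definition word_term (w : free_group 'I_n) : term C n :=
  foldr (fun a => Mul (letter_term a)) (One C n) (val w).

Lemma eval_word_term (G : groupType) (c : C -> G) (v : 'I_n -> G) w :
  eval c v (word_term w) = word_value v w.
Proof.
rewrite word_valueE /word_term; elim: (val w) => [|a s IHs] /=.
  by rewrite /seq_value big_nil.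
by rewrite seq_value_cons IHs; case: a => i [].
Qed.

End WordTerm.

(** Two elements freely generate a subgroup exactly when they realize the type
  that excludes every nontrivial relation.  If this is not a type, finitely
  many words cover all pairs of elements by their zero sets, and
  [combine_word_list] makes an identity of them. *)
Lemma saturated_free_or_identity (G : groupType) : aleph0_saturated G ->
  contains_free_nonabelian G \/ satisfies_nontrivial_identity G.
Proof.
move=> Gsat; pose neq (w : free_group 'I_2) : formula (set0 : set G) 2 :=
  Imp (Eq (word_term _ w) (One _ _)) (Bot _ _).
pose p := [set phi | exists2 w, w <> 1 & phi = neq w].
have neqP w (v : 'I_2 -> G) : holds val (neq w) v <-> word_value v w <> 1.
  by rewrite /= eval_word_term.
have [ptype|ntype] := pselect (is_type p); [left|right].
  have [v vp] := Gsat _ _ _ (finite_set0 G) ptype.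
  exists 'I_2, (bundle_morphism (word_valueM v)); split.
    apply: (morphism_inj (word_valueM v)) => w; apply: contraPP => w1.
    by apply/neqP/vp; exists w.
  pose x : free_group 'I_2 := letter_word ord0.
  pose y : free_group 'I_2 := letter_word ord_max.
  by move=> /(_ x y)/(congr1 val).
have [q qfin [qp nq]] : exists2 q, finite_set q &
    q `<=` p /\ forall v : 'I_2 -> G, exists2 phi, q phi & ~ holds val phi v.
  move/existsNP: ntype => [q /not_implyP[qfin /not_implyP[qp nq]]].
  exists q => //; split=> // v; apply: contrapT => nphi; apply: nq;
    exists v => phi qphi.
  by apply: contrapT => nh; apply: nphi; exists phi.
(* Each formula of [q] excludes one relation; [W] recovers it. *)
have /choice[W WP] phi : exists w, p phi -> w <> 1 /\ phi = neq w.
  by have [[w w1 ->]|np] := pselect (p phi); [exists w|exists 1].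
have /finite_seqP[ws wsE] : finite_set (W @` q) by exact: finite_image.
have ws1 w : w \in ws -> w <> 1.
  move=> wws; have : (W @` q) w by rewrite wsE.
  by move=> [phi /qp/WP[w1 _] <-].
have inws phi : q phi -> W phi \in ws.
  by move=> qphi; have : (W @` q) (W phi) by [exists phi]; rewrite wsE.
have ws0 : ws != [::].
  by have [phi /inws] := nq (fun=> 1); case: (ws).
have [n [h [w [w1 ww]]]] := combine_word_list ws1 ws0.
exists n, w; split=> // g; apply: ww.
have [phi qphi nphi] := nq (g \o h); exists (W phi); first exact: inws.
have [_ phiE] := WP phi (qp _ qphi); apply: contrapT => /neqP.
by rewrite -phiE.
Qed.

(** * First-order definability of Folner sets *)

(** Valuations are turned into sequences, in which a quantifier prepends its
  variable; concatenation then describes blocks of quantifiers. *)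
Definition env_seq (T : Type) n (v : 'I_n -> T) : seq T :=
  [seq v i | i <- enum 'I_n].

Lemma env_seq_cons (T : Type) n (x : T) (v : 'I_n -> T) :
  env_seq (env_cons x v) = x :: env_seq v.
Proof.
rewrite /env_seq enum_ordSl /= -map_comp /env_cons unlift_none; congr (_ :: _).
by apply: eq_map => j /=; rewrite liftK.
Qed.

Lemma nth_env_seq (G : groupType) n (v : 'I_n -> G) (i : 'I_n) :
  (env_seq v)`_i = v i.
Proof. by rewrite (nth_map i) ?size_enum_ord // nth_ord_enum. Qed.

Definition definable n (P : forall G : groupType, seq G -> Prop) : Prop :=
  exists phi : formula void n, forall (G : groupType) (v : 'I_n -> G),
    holds (of_void G) phi v <-> P G (env_seq v).

Section Definable.
Implicit Types (n : nat) (P Q : forall G : groupType, seq G -> Prop).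

Lemma definable_ext n P Q : (forall G s, P G s <-> Q G s) ->
  definable n P -> definable n Q.
Proof. by move=> PQ [phi phiP]; exists phi => G v; rewrite phiP. Qed.

Lemma definable_false n : definable n (fun _ _ => False).
Proof. by exists (Bot _ n). Qed.

Lemma definable_imp n P Q : definable n P -> definable n Q ->
  definable n (fun G s => P G s -> Q G s).
Proof.
by move=> [phi phiP] [psi psiQ]; exists (Imp phi psi) => G v /=;
  rewrite phiP psiQ.
Qed.

Lemma definable_not n P : definable n P -> definable n (fun G s => ~ P G s).
Proof. by move=> nP; exact: definable_imp nP (definable_false n). Qed.

Lemma definable_and n P Q : definable n P -> definable n Q ->
  definable n (fun G s => P G s /\ Q G s).
Proof.
move=> nP nQ; apply: definable_ext (definable_not (definable_imp nP
  (definable_not nQ))).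
move=> G s; split=> [h|[p q] /(_ p)//].
by split; apply: contrapT => nh; apply: h => // p; have := nh p.
Qed.

Lemma definable_iff n P Q : definable n P -> definable n Q ->
  definable n (fun G s => P G s <-> Q G s).
Proof. by move=> nP nQ; apply: definable_and; apply: definable_imp. Qed.

Lemma definable_all n P : definable n.+1 P ->
  definable n (fun G s => forall x : G, P G (x :: s)).
Proof.
move=> [phi phiP]; exists (All phi) => G v /=.
by split=> h x; have := h x; rewrite phiP env_seq_cons.
Qed.

Lemma definable_all_in n (T : eqType) (l : seq T)
    (P : T -> forall G : groupType, seq G -> Prop) :
  (forall t, definable n (P t)) ->
  definable n (fun G s => forall t, t \in l -> P t G s).
Proof.
move=> nP; elim: l => [|t l IHl].
  apply: definable_ext (definable_not (definable_false n)) => G s.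
  by split=> [_ t|_ []]; rewrite ?in_nil.
apply: definable_ext (definable_and (nP t) IHl) => G s; split.
  by move=> [p pl] u; rewrite inE => /predU1P[->|/pl].
by move=> h; split=> [|u ul]; apply: h; rewrite inE ?eqxx ?ul ?orbT.
Qed.

Lemma definable_ex_in n (T : eqType) (l : seq T)
    (P : T -> forall G : groupType, seq G -> Prop) :
  (forall t, definable n (P t)) ->
  definable n (fun G s => exists2 t, t \in l & P t G s).
Proof.
move=> nP; apply: definable_ext
  (definable_not (definable_all_in l (fun t => definable_not (nP t)))) => G s.
split=> [h|[t tl p] /(_ t tl)//].
by apply: contrapT => nex; apply: h => t tl p; apply: nex; exists t.
Qed.

Lemma definable_all_seq m n P : definable (m + n) P ->
  definable n (fun G s => forall t, size t = m -> P G (t ++ s)).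
Proof.
elim: m P => [|m IHm] P mP.
  by apply: definable_ext mP => G s; split=> [p [|//]|/(_ [::])]; [|exact].
apply: definable_ext (IHm _ (definable_all mP)) => G s; split.
  by move=> h [//|x t] [tm]; exact: h.
by move=> h t tm x; apply: (h (x :: t)); rewrite /= tm.
Qed.

Lemma definable_ex_seq m n P : definable (m + n) P ->
  definable n (fun G s => exists2 t, size t = m & P G (t ++ s)).
Proof.
move=> mP; apply: definable_ext
  (definable_not (definable_all_seq (definable_not mP))) => G s.
split=> [h|[t tm p] /(_ t tm)//].
by apply: contrapT => nex; apply: h => t tm p; apply: nex; exists t.
Qed.

Lemma definable_sentence P : definable 0 P ->
  exists phi : sentence, forall G : groupType, satisfies G phi <-> P G [::].
Proof.
move=> [phi phiP]; exists phi => G; rewrite /satisfies phiP.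
by rewrite /env_seq enum_ord0.
Qed.

End Definable.

Definition definable_elt n (x : forall G : groupType, seq G -> G) : Prop :=
  exists t : term void n, forall (G : groupType) (v : 'I_n -> G),
    eval (of_void G) v t = x G (env_seq v).

Lemma definable_nth n i : definable_elt n (fun G s => s`_i).
Proof.
have [ni|ni] := ltnP i n; last first.
  by exists (One _ n) => G v; rewrite nth_default // size_map size_enum_ord.
by exists (Var _ (Ordinal ni)) => G v; rewrite (nth_env_seq v (Ordinal ni)).
Qed.

Lemma definable_one n : definable_elt n (fun G s => 1).
Proof. by exists (One _ n). Qed.

Lemma definable_mul n x y : definable_elt n x -> definable_elt n y ->
  definable_elt n (fun G s => x G s * y G s).
Proof. by move=> [t tx] [u uy]; exists (Mul t u) => G v /=; rewrite tx uy. Qed.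

Lemma definable_eq n x y : definable_elt n x -> definable_elt n y ->
  definable n (fun G s => x G s = y G s).
Proof. by move=> [t tx] [u uy]; exists (Eq t u) => G v /=; rewrite tx uy. Qed.

Lemma definable_word_value k (w : free_group 'I_k) :
  definable k (fun G s => word_value (fun i : 'I_k => s`_i) w = 1).
Proof.
apply: definable_eq (definable_one k).
exists (word_term _ w) => G v; rewrite eval_word_term.
by congr word_value; apply/funext => i; rewrite nth_env_seq.
Qed.

Lemma definable_word_identity k (w : free_group 'I_k) :
  definable 0 (fun G _ => word_identity G w).
Proof.
have kw : definable (k + 0)
    (fun G s => word_value (fun i : 'I_k => s`_i) w = 1).
  by rewrite addn0; exact: definable_word_value.
apply: definable_ext (definable_all_seq kw) => G s; split=> [h g|h t _];
  last exact: h.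
have := h (env_seq g); rewrite size_map size_enum_ord => /(_ erefl) <-.
congr word_value; apply/funext => i.
by rewrite nth_cat size_map size_enum_ord ltn_ord nth_env_seq.
Qed.

(** The disjunction runs over the equality patterns that occur, in whatever
  group, together with [Q]; by invariance each of them implies [Q]. *)
Lemma definable_pattern n (T : finType)
    (x : T -> forall G : groupType, seq G -> G)
    (Q : forall G : groupType, (T -> G) -> Prop) :
    (forall t, definable_elt n (x t)) ->
    (forall (G H : groupType) (u : T -> G) (v : T -> H),
       (forall t t', u t = u t' <-> v t = v t') -> Q G u -> Q H v) ->
  definable n (fun G s => Q G (fun t => x t G s)).
Proof.
move=> nx Qinv.
pose pat (e : {set T * T}) (G : groupType) (u : T -> G) :=
  forall p : T * T, p \in enum predT -> (u p.1 = u p.2 <-> p \in e).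
pose E := [seq e <- enum predT |
  `[< exists (G : groupType) (u : T -> G), pat e G u /\ Q G u >]].
have patE (e : {set T * T}) :
    definable n (fun G s => pat e G (fun t => x t G s)).
  apply: definable_all_in => p; apply: definable_iff.
    exact: definable_eq.
  case: (p \in e); last by apply: definable_ext (definable_false n) => G s;
    split.
  by apply: definable_ext (definable_not (definable_false n)) => G s;
    split=> // _ [].
apply: definable_ext (definable_ex_in E patE) => G s; split.
  move=> [e]; rewrite mem_filter => /andP[/asboolP[H [u [eu Qu]]] _] es.
  apply: Qinv Qu => t t'.
  by rewrite (eu (t, t')) ?mem_enum // (es (t, t')) ?mem_enum.
move=> Qs; pose e : {set T * T} :=
  [set p : T * T | x p.1 G s == x p.2 G s]%SET.
have es : pat e G (fun t => x t G s).
  by move=> p _; rewrite inE; split=> [->|/eqP].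
exists e => //; rewrite mem_filter mem_enum andbT; apply/asboolP.
by exists G, (fun t => x t G s).
Qed.

Lemma size_undup_map_eq (T X Y : eqType) (u : T -> X) (v : T -> Y)
    (l : seq T) :
  (forall t t', u t = u t' <-> v t = v t') ->
  size (undup (map u l)) = size (undup (map v l)).
Proof.
move=> uv; elim: l => //= t l IHl.
have -> : (u t \in map u l) = (v t \in map v l).
  by apply/mapP/mapP => -[t' t'l /uv tt']; exists t'.
by case: ifP; rewrite /= IHl.
Qed.

Section FolnerDefinable.
Variables (R : realType) (eps : R) (n N : nat).

(** The first [N] entries of [s] list a candidate Folner set for the
  remaining ones. *)
Definition folner_seq (G : groupType) (s : seq G) : Prop :=
  folner eps [fset x in drop N s]%fset [fset x in take N s]%fset.

(** Both the elements [s`_j] of the candidate set (first component [None])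
  and their translates [s`_(N + i) * s`_j] are indexed by one finite type, so
  that the Folner condition depends on the equality pattern of one family. *)
Definition pair_elt (t : option 'I_n * 'I_N) (G : groupType) (s : seq G) : G :=
  (if t.1 is Some i then s`_(N + i) else 1) * s`_(t.2).

Definition folner_pattern (G : groupType)
    (u : option 'I_n * 'I_N -> G) : Prop :=
  ((size (undup [seq u t |
       t <- [seq (Some i, j) | i <- enum 'I_n, j <- enum 'I_N]]))%:R
   < (1 + eps) *
     (size (undup [seq u t | t <- [seq (None, j) | j <- enum 'I_N]]))%:R)%R.

Lemma folner_patternE (G : groupType) (s : seq G) : size s = (N + n)%N ->
  folner_pattern (fun t => pair_elt t s) <-> folner_seq s.
Proof.
move=> sn; rewrite /folner_pattern /folner_seq /folner -!card_fseq.
have nthV (j : 'I_N) : s`_j \in take N s.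
  by rewrite -(nth_take 1 (ltn_ord j)) mem_nth // size_takel // sn leq_addr.
have nthA (i : 'I_n) : s`_(N + i) \in drop N s.
  by rewrite -nth_drop mem_nth // size_drop sn addKn.
have Vnth x : x \in take N s -> exists j : 'I_N, x = s`_j.
  move=> /(nthP 1)[j]; rewrite size_takel ?sn ?leq_addr // => jN <-.
  by exists (Ordinal jN); rewrite /= nth_take.
have Anth x : x \in drop N s -> exists i : 'I_n, x = s`_(N + i).
  move=> /(nthP 1)[i]; rewrite size_drop sn addKn => ni <-.
  by exists (Ordinal ni); rewrite nth_drop.
set V1 := [fset x in _]%fset; set V2 := [fset x in _]%fset.
set V3 := left_mul _ _; set V4 := [fset x in _]%fset.
have -> : V1 = V3.
  apply/fsetP => x; rewrite inE; apply/mapP/left_mulP.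
    move=> [_ /allpairsP[[i j] [_ _ ->]] ->]; exists s`_(N + i), s`_j.
    by rewrite !inE nthA nthV.
  move=> [a [v []]]; rewrite !inE => /Anth[i ->] /Vnth[j ->] ->.
  by exists (Some i, j); rewrite // allpairs_f ?mem_enum.
suff -> : V2 = V4 by [].
apply/fsetP => x; rewrite !inE; apply/mapP/idP.
  by move=> [_ /mapP[j _ ->] ->]; rewrite /pair_elt /= mul1g nthV.
move=> /Vnth[j ->]; exists (None, j); first by rewrite map_f ?mem_enum.
by rewrite /pair_elt mul1g.
Qed.

End FolnerDefinable.

Lemma definable_folner (R : realType) (eps : R) n N :
  definable (N + n) (fun G s =>
    folner_pattern eps (fun t : option 'I_n * 'I_N => pair_elt t s)).
Proof.
apply: (definable_pattern (x := @pair_elt n N)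
  (Q := @folner_pattern R eps n N)).
  move=> [i j].
  apply: (definable_mul (x := fun G s => if i is Some i then s`_(N + i) else 1)
    (y := fun G s => s`_j)); last exact: definable_nth.
  by case: i => [i|]; [exact: definable_nth|exact: definable_one].
by move=> G H u v uv; rewrite /folner_pattern !(size_undup_map_eq _ uv).
Qed.

Lemma folner_sentence (R : realType) (eps : R) k (w : free_group 'I_k) n N :
  exists phi : sentence, forall G : groupType, satisfies G phi <->
    (word_identity G w -> forall a : seq G, size a = n ->
       exists2 v : seq G, size v = N &
         folner eps [fset x in a]%fset [fset x in v]%fset).
Proof.
have fol : definable (n + 0) (fun G a => exists2 v : seq G, size v = N &
    folner_pattern eps (fun t : option 'I_n * 'I_N => pair_elt t (v ++ a))).
  rewrite addn0; exact: (definable_ex_seq (definable_folner eps n N)).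
have [phi phiP] := definable_sentence
  (definable_imp (definable_word_identity w) (definable_all_seq fol)).
exists phi => G; rewrite phiP.
have catE (a v : seq G) : size a = n -> size v = N ->
    folner_pattern eps (fun t : option 'I_n * 'I_N => pair_elt t (v ++ a)) <->
    folner eps [fset x in a]%fset [fset x in v]%fset.
  move=> an vN; rewrite folner_patternE ?size_cat ?an ?vN // /folner_seq.
  by rewrite -vN take_size_cat // drop_size_cat.
split=> h Gw a an; have [v vN fv] := h Gw a an; exists v => //.
  by apply/catE => //; move: fv; rewrite cats0.
by rewrite cats0; apply/catE.
Qed.

Lemma folner_eql (R : realType) (eps : R) (G : groupType) (A B V : {fset G}) :
  A =i B -> folner eps A V -> folner eps B V.
Proof. by move=> /fsetP ->. Qed.

(** Repetitions allow all Folner sets of at most [N] elements to be listed by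
  sequences of the same length. *)
Lemma folner_nseq_pad (R : realType) (eps : R) (G : groupType)
    (A V : {fset G}) N :
    folner eps A V -> (#|` V| <= N)%N ->
  exists2 v : seq G, size v = N & folner eps A [fset x in v]%fset.
Proof.
move=> fol VN; have : (0 < #|` V|)%N by exact: folner_card_gt0 fol.
rewrite cardfs_gt0 => /fset0Pn[x xV].
exists (enum_fset V ++ nseq (N - #|` V|) x).
  by rewrite size_cat size_nseq subnKC.
suff -> : [fset y in enum_fset V ++ nseq (N - #|` V|) x]%fset = V by [].
apply/fsetP => y; rewrite !inE mem_nseq.
by have [->|_] := eqVneq y x; rewrite ?xV ?andbF ?orbF.
Qed.

Lemma residually_finite_finite (F : finGroupType) : residually_finite F.
Proof. by move=> g g1; exists F, idfun. Qed.

(** Among the groups to which the uniform bound applies are all finite groups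
  with the identity in question, so that a single sentence, true in all
  finite groups, expresses it. *)
Theorem pseudofinite_identity_folner (R : realType) (G : groupType) :
    (forall H : groupType, finitely_generated H -> residually_finite H ->
       satisfies_nontrivial_identity H -> has_folner_sets R H) ->
  pseudofinite G -> satisfies_nontrivial_identity G -> has_folner_sets R G.
Proof.
move=> folH Gpf [k [w [w1 Gw]]] A eps eps01.
have [N NP] := uniform_folner #|` A| w1 eps01 folH.
have [phi phiP] := folner_sentence eps w #|` A| N.
have /phiP/(_ Gw (enum_fset A) erefl)[v _ fv] : satisfies G phi.
  apply: Gpf => F; apply/phiP => Fw a an.
  have [V VN fV] := NP F (@residually_finite_finite F) Fw a an.
  exact: folner_nseq_pad fV VN.
by exists [fset x in v]%fset; apply: folner_eql fv => x; rewrite inE.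
Qed.

(** * The equivalence *)

Lemma folner_uniformly_amenable (R : realType) (G : groupType) k
    (w : free_group 'I_k) :
    w <> 1 -> word_identity G w -> residually_finite G ->
    (forall H : groupType, finitely_generated H -> residually_finite H ->
       satisfies_nontrivial_identity H -> has_folner_sets R H) ->
  uniformly_amenable R G.
Proof.
move=> w1 Gw Grf folH.
have /choice[alpha alphaP] (p : R * nat) : exists N, (0 < p.1 <= 1)%R ->
    forall s : seq G, size s = p.2 ->
    exists2 V : {fset G}, (#|` V| <= N)%N & folner p.1 [fset x in s]%fset V.
  have [p01|np01] := boolP (0 < p.1 <= 1)%R; last by exists 0%N.
  by have [N NP] := uniform_folner p.2 w1 p01 folH; exists N => _; exact: NP.
exists (fun eps n => alpha (eps, n)) => A eps eps01.
have [V VN fV] := alphaP (eps, #|` A|) eps01 (enum_fset A) erefl.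
have fA : folner eps A V by apply: folner_eql fV => x; rewrite inE.
by exists V.
Qed.

Lemma uniformly_amenable_folner (R : realType) (G : groupType) :
  uniformly_amenable R G -> has_folner_sets R G.
Proof.
move=> [alpha alphaP] A eps eps01; have [V _ fV] := alphaP A eps eps01.
by exists V.
Qed.

Theorem theorem5p1 (R : realType) :
  [<->
    (forall G : groupType, aleph0_saturated G -> pseudofinite G ->
       contains_free_nonabelian G \/ amenable R G);
    (forall (I : Type) (U : set_system I) (UU : UltraFilter U)
            (F : I -> finGroupType),
       contains_free_nonabelian (ultraproduct U (fun i => F i)) \/
       amenable R (ultraproduct U (fun i => F i)));
    (forall G : groupType,
       finitely_generated G -> residually_finite G ->
       satisfies_nontrivial_identity G -> amenable R G);
    (forall G : groupType,
       finitely_generated G -> residually_finite G ->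
       satisfies_nontrivial_identity G -> uniformly_amenable R G)].
Proof.
tfae.
- move=> alt I U UU F; apply: alt; first exact: ultraproduct_saturated.
  exact: ultraproduct_pseudofinite.
- move=> alt G _; exact: ultraproduct_alternative_amenable.
- move=> am G _ Grf [k [w [w1 Gw]]].
  apply: (folner_uniformly_amenable w1 Gw Grf) => H Hfg Hrf Hw.
  exact/amenable_folner/am.
- move=> uam G Gsat Gpf.
  have [|Gw] := saturated_free_or_identity Gsat; first by left.
  right; apply: folner_amenable;
    apply: pseudofinite_identity_folner Gw => // H Hfg Hrf Hw.
  exact/uniformly_amenable_folner/uam.
Qed.
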